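(* Let $n\ge1$ and let $\Sigma=\Sigma^+\cup\Sigma^-$ be a rotationally symmetric compact hypersurface in the Heisenberg group $\mathbb{H}_n$ obtained by rotating a hypersurface in $\mathbb{R}^{2n}$ about the $x_{2n+1}$-axis (the $z$-axis), where $\Sigma^+=\{x_{2n+1}=h^+\ge0\}$ and $\Sigma^-=\{x_{2n+1}=h^-\le0\}$ for some functions $h^\pm=h^\pm(r)$ defined on $[0,R]$ for some $R>0$, with $r=\sqrt{\sum_{j=1}^n(x_j^2+y_j^2)}$. Suppose $h^+$ and $h^-$ satisfy any of the following conditions: (1) $\frac{dh^+}{dr}$ or $\frac{dh^-}{dr}$ is continuous on the interval $[0,R]$; (2) $\left|\frac{dh^+}{dr}\right|$ or $\left|\frac{dh^-}{dr}\right|$ is bounded by $\frac{r}{\sqrt{R^2-r^2}}$ on the interval $[0,R)$. Denote by $\tilde N(p)$ any unit p-normal vector at a point $p$ of the Pansu sphere $\mathcal{P}^n_\lambda$. Then the projected p-area of $\Sigma$ onto $\tilde N(p)^\perp$ is given by $$\mathcal{A}(\Sigma|\tilde N(p)^\perp)=\int_{q\in\Sigma}\big|L_{qp^{-1}*}\tilde N(p)\cdot N(q)\big|\,d\Sigma_q=C,$$ where $N(q)$ is the unit p-normal vector at $q\in\Sigma$ and $C$ is a constant independent of the choice of $\tilde N(p)$. In particular, if $\Sigma=\mathcal{P}^n_\lambda$, then the projected p-area equals $$2\,\omega_{2n-1}\,\frac{\sqrt{\pi}}{\lambda^{2n+1}}\,\frac{\Gamma(n+\frac12)}{\Gamma(n+1)},$$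 where $\omega_{2n-1}$ is the volume of the unit ball in $\mathbb{R}^{2n-1}$ and $\Gamma$ is the Gamma function.
   Context: The Heisenberg group $\mathbb{H}_n$ is $\mathbb{R}^{2n+1}$ with coordinates $(x_1,y_1,\dots,x_n,y_n,z)$, where $z$ is also written $x_{2n+1}$, and group law given by left translation $L_{(x,y,z)}(x',y',z')=\big(x+x',\,y+y',\,z+z'+\sum_{i=1}^n(y_ix'_i-x_iy'_i)\big)$. For $p,q\in\mathbb{H}_n$, $L_{qp^{-1}}=L_q\circ L_{p^{-1}}$, and $L_{qp^{-1}*}$ is its pushforward (differential). The left-invariant vector fields $\mathring e_{x_j}=\partial_{x_j}+y_j\partial_z$, $\mathring e_{y_j}=\partial_{y_j}-x_j\partial_z$ ($1\le j\le n$) span the contact hyperplanes $\xi=\ker\big(dz+\sum_j(x_jdy_j-y_jdx_j)\big)$. The Levi metric, written $\cdot$, is the inner product on $\xi$ for which $\{\mathring e_{x_j},\mathring e_{y_j}\}$ is orthonormal. $\tilde N(p)^\perp$ is the orthogonal complement of $\tilde N(p)$ in $T_p\mathbb{H}_n$. A point $p$ of a hypersurface $\Sigma$ is singular if $T_p\Sigma=\xi_p$, and nonsingular otherwise; at a nonsingular point the p-normal vector in $\xi_p$ is the unit vector (unique up to sign) Levi-orthogonal to $T_p\Sigma\cap\xi_p$. For a graph $z=f(x,y)$, with $D=\big[\sum_j (f_{x_j}-y_j)^2+(f_{y_j}+x_j)^2\big]^{1/2}$, the p-area element is $d\Sigma=D\,dx_1dy_1\cdots dx_ndy_n$ and the p-normal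 is $\frac{-1}{D}\sum_j[(f_{x_j}-y_j)\mathring e_{x_j}+(f_{y_j}+x_j)\mathring e_{y_j}]$ up to sign. Integrals over $\Sigma=\Sigma^+\cup\Sigma^-$ (and over the Pansu sphere) are sums of the integrals over the two graphs. For $\lambda>0$, the Pansu sphere $\mathcal{P}^n_\lambda$ is the union of the graphs $z=f$ and $z=-f$ over $\{r\le 1/\lambda\}$, where $f=\frac{1}{2\lambda^2}\big(\lambda r\sqrt{1-\lambda^2r^2}+\cos^{-1}(\lambda r)\big)$. Its only singular points are the two poles $(0,\dots,0,\pm\frac{\pi}{4\lambda^2})$, and $\tilde N(p)$ is defined at all other points. *)

(* Defs.v *)
From HB Require Import structures.
From mathcomp Require Import all_boot all_order all_algebra.
From mathcomp Require Import all_classical all_reals all_analysis.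

Set Implicit Arguments.
Unset Strict Implicit.
Unset Printing Implicit Defensive.

Import Order.TTheory GRing.Theory Num.Theory.
Import numFieldNormedType.Exports.

Local Open Scope classical_set_scope.
Local Open Scope ring_scope.

(** * Lebesgue measure on R^m, carried by m.-tuples *)

Section lebesgue_tuple.
Variable R : realType.
Local Notation RT := (measurableTypeR R).

Definition cons_pair (m : nat) (p : RT * m.-tuple RT) : m.+1.-tuple RT :=
  [tuple of p.1 :: p.2].

Lemma measurable_cons_pair (m : nat) :
  measurable_fun [set: RT * m.-tuple RT] (@cons_pair m).
Proof. by apply: measurable_cons. Qed.

Definition lebesgue_cons (m : nat)
    (mu : {sigma_finite_measure set (m.-tuple RT) -> \bar R}) :
    set (m.+1.-tuple RT) -> \bar R :=
  pushforward (lebesgue_measure \x mu)%E (@cons_pair m).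

Section instances.
Variables (m : nat) (mu : {sigma_finite_measure set (m.-tuple RT) -> \bar R}).

Let lc0 : lebesgue_cons mu set0 = 0%E.
Proof. by rewrite /lebesgue_cons /pushforward preimage_set0 measure0. Qed.

Let lc_ge0 A : (0 <= lebesgue_cons mu A)%E.
Proof. by rewrite /lebesgue_cons /pushforward measure_ge0. Qed.

Let lc_sigma : semi_sigma_additive (lebesgue_cons mu).
Proof.
move=> F mF tF mUF; rewrite /lebesgue_cons /pushforward preimage_bigcup.
have mc := @measurable_cons_pair m.
apply: measure_semi_sigma_additive.
- by move=> n; rewrite -[X in measurable X]setTI; exact: mc.
- apply/trivIsetP => /= i j _ _ ij; rewrite -preimage_setI.
  by move/trivIsetP : tF => /(_ _ _ _ _ ij) ->//; rewrite preimage_set0.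
- by rewrite -preimage_bigcup -[X in measurable X]setTI; exact: mc.
Qed.

HB.instance Definition _ := isMeasure.Build _ _ _ (lebesgue_cons mu)
  lc0 lc_ge0 lc_sigma.

Let lc_sigma_finite : sigma_finite setT (lebesgue_cons mu).
Proof.
have [F TF mF] : sigma_finite setT (lebesgue_measure \x mu)%E.
  have /sigma_finiteP[F [TF ndF Foo]] :=
    sigma_finiteT (lebesgue_measure : {sigma_finite_measure set RT -> \bar R}).
  have /sigma_finiteP[G [TG ndG Goo]] := sigma_finiteT mu.
  exists (fun k => F k `*` G k).
    rewrite -setXTT TF TG; apply/seteqP; split => -[x y] /=.
      move=> [[i _ Fx] [j _ Gy]]; exists (maxn i j) => //; split.
        by move: x Fx; exact/subsetPset/ndF/leq_maxl.
      by move: y Gy; exact/subsetPset/ndG/leq_maxr.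
    by move=> [i _ []/= ? ?]; split; exists i.
  move=> k; have [? ?] := Foo k; have [? ?] := Goo k.
  split; first exact: measurableX.
  by rewrite product_measure1E// lte_mul_pinfty// ge0_fin_numE.
pose unc (t : m.+1.-tuple RT) : RT * m.-tuple RT := (thead t, [tuple of behead t]).
have munc : measurable_fun setT unc.
  apply: measurable_fun_pair; last exact: measurable_behead.
  exact: measurable_tnth.
have cK : cancel (@cons_pair m) unc.
  by move=> [x t]; rewrite /unc /=; congr pair; apply/val_inj.
exists (fun i => unc @^-1` F i).
  by rewrite -preimage_bigcup -TF preimage_setT.
move=> i; split.
  by rewrite -[X in measurable X]setTI; apply: munc => //; exact: (mF i).1.
have -> : lebesgue_cons mu (unc @^-1` F i) = (lebesgue_measure \x mu)%E (F i).
  rewrite /lebesgue_cons /pushforward; congr (_ _).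
  by apply/seteqP; split => p /=; rewrite cK.
exact: (mF i).2.
Qed.

HB.instance Definition _ := Measure_isSigmaFinite.Build _ _ _
  (lebesgue_cons mu) lc_sigma_finite.

End instances.

Fixpoint lebesgue_tuple (m : nat) :
    {sigma_finite_measure set (m.-tuple RT) -> \bar R} :=
  if m is k.+1 then lebesgue_cons (lebesgue_tuple k)
  else dirac ([tuple] : 0.-tuple RT).

Lemma lebesgue_tuple_box (m : nat) (A : 'I_m -> set RT) :
  (forall i, measurable (A i)) ->
  lebesgue_tuple m [set t | forall i, A i (tnth t i)] =
  (\prod_(i < m) lebesgue_measure (A i))%E.
Proof.
elim: m A => [|m IH] A mA.
  by rewrite big_ord0 /= diracE mem_set// => -[].
rewrite big_ord_recl -IH//= /lebesgue_cons /pushforward.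
have mB : measurable [set t : m.-tuple RT | forall i, A (lift ord0 i) (tnth t i)].
  rewrite [X in measurable X](_ : _ =
      \big[setI/setT]_(i < m) ((fun t => tnth t i) @^-1` A (lift ord0 i))).
    apply: bigsetI_measurable => i _.
    by rewrite -[X in measurable X]setTI; exact: measurable_tnth.
  rewrite -bigcap_seq; apply/seteqP; split => t /= h; first by move=> i _; exact: h.
  by move=> i; apply: h; rewrite /= mem_index_enum.
rewrite -product_measure1E//; congr (_ _).
apply/seteqP; split => -[x t] /=.
  move=> h; split; first by have := h ord0; rewrite tnth0.
  by move=> i; have := h (lift ord0 i); rewrite tnthS.
move=> [h0 hS] i; have [j ->|->] := unliftP ord0 i; last by rewrite tnth0.
by rewrite tnthS; exact: hS.
Qed.

End lebesgue_tuple.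

(** * The Heisenberg group *)

(* A point ((x, y), z) of H_n.  Tangent vectors have the same type and are
   written in the coordinate basis d/dx_j, d/dy_j, d/dz. *)
Notation heis R n := ('rV[R]_n * 'rV[R]_n * R)%type (only parsing).

Section heisenberg.
Variables (R : realType) (n : nat).
Implicit Types (p q u v : heis R n) (S : set (heis R n)).

Definition xc p (j : 'I_n) : R := p.1.1 ord0 j.
Definition yc p (j : 'I_n) : R := p.1.2 ord0 j.

Definition heis_mul p q : heis R n :=
  (p.1.1 + q.1.1, p.1.2 + q.1.2,
   p.2 + q.2 + \sum_(j < n) (yc p j * xc q j - xc p j * yc q j)).

Definition heis_inv p : heis R n := (- p.1.1, - p.1.2, - p.2).

(* L_{q p^-1 *} v, for v tangent at p; the result is tangent at q. *)
Definition push_left q p v : heis R n :=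
  'd (heis_mul (heis_mul q (heis_inv p))) p v.

Definition frame_x (j : 'I_n) p : heis R n := (delta_mx 0 j, 0, yc p j).
Definition frame_y (j : 'I_n) p : heis R n := (0, delta_mx 0 j, - xc p j).

Definition contact p : set (heis R n) :=
  [set v | v.2 + \sum_(j < n) (xc p j * yc v j - yc p j * xc v j) = 0].

(* On the contact plane the components of v along frame_x j and frame_y j are
   xc v j and yc v j (see contact_frameE), so this is the inner product making
   the frame orthonormal; only its values on a contact plane are meaningful. *)
Definition levi u v : R :=
  \sum_(j < n) (xc u j * xc v j + yc u j * yc v j).

Lemma contact_frameE p v : contact p v <->
  v = \sum_(j < n) (xc v j *: frame_x j p + yc v j *: frame_y j p).
Proof.
rewrite /contact /=.
have E1 : (\sum_(j < n) (xc v j *: frame_x j p + yc v j *: frame_y j p)).1.1 = v.1.1.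
  rewrite (big_morph (fun u : heis R n => u.1.1) (id1 := 0) (op1 := +%R))//.
  rewrite [RHS]row_sum_delta; apply: eq_bigr => j _ /=.
  by rewrite scaler0 addr0.
have E2 : (\sum_(j < n) (xc v j *: frame_x j p + yc v j *: frame_y j p)).1.2 = v.1.2.
  rewrite (big_morph (fun u : heis R n => u.1.2) (id1 := 0) (op1 := +%R))//.
  rewrite [RHS]row_sum_delta; apply: eq_bigr => j _ /=.
  by rewrite scaler0 add0r.
have E3 : (\sum_(j < n) (xc v j *: frame_x j p + yc v j *: frame_y j p)).2 =
    - \sum_(j < n) (xc p j * yc v j - yc p j * xc v j).
  rewrite (big_morph (fun u : heis R n => u.2) (id1 := 0) (op1 := +%R))//.
  rewrite -sumrN; apply: eq_bigr => j _ /=.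
  by rewrite /GRing.scale/= mulrN opprB mulrC [yc v j * _]mulrC.
split => [/eqP|vE]; last by rewrite {1}vE E3 addNr.
rewrite addr_eq0 => /eqP v2; rewrite -v2 in E3.
move: E1 E2 E3; set w := \sum_(j < n) _.
by case: w => [[? ?] ?]; case: v {v2} => [[? ?] ?] /= -> -> ->.
Qed.

(* Velocities of curves in S differentiable at p; at a point where S is a C^1
   hypersurface this is the usual tangent space. *)
Definition tangent S p : set (heis R n) :=
  [set v | exists g : R -> heis R n,
    [/\ g 0 = p, \forall t \near 0, S (g t) & is_derive (0 : R) (1 : R) g v]].

Definition nonsingular S p : Prop := tangent S p <> contact p.

Definition is_pnormal S p v : Prop :=
  [/\ S p, nonsingular S p, contact p v, levi v v = 1 &
      forall u, tangent S p u -> contact p u -> levi v u = 0].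

(** * Rotationally symmetric hypersurfaces *)

Definition radius (w : 'rV[R]_n * 'rV[R]_n) : R :=
  Num.sqrt (\sum_(j < n) (w.1 ord0 j ^+ 2 + w.2 ord0 j ^+ 2)).

Definition sheet (Rr : R) (h : R -> R) : set (heis R n) :=
  [set p | radius p.1 <= Rr /\ p.2 = h (radius p.1)].

Definition rot_surface (Rr : R) (hp hm : R -> R) : set (heis R n) :=
  sheet Rr hp `|` sheet Rr hm.

(* D of the p-area element D dx_1 dy_1 ... dx_n dy_n of the graph z = f. *)
Definition area_density (f : 'rV[R]_n * 'rV[R]_n -> R)
    (w : 'rV[R]_n * 'rV[R]_n) : R :=
  Num.sqrt (\sum_(j < n)
    (('D_((delta_mx 0 j, 0) : 'rV[R]_n * 'rV[R]_n) f w - w.2 ord0 j) ^+ 2 +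
     ('D_((0, delta_mx 0 j) : 'rV[R]_n * 'rV[R]_n) f w + w.1 ord0 j) ^+ 2)).

Definition row_pair
    (t : n.-tuple (measurableTypeR R) * n.-tuple (measurableTypeR R)) :
    'rV[R]_n * 'rV[R]_n :=
  (\row_j tnth t.1 j, \row_j tnth t.2 j).

(* Integral of phi against the p-area of the sheet z = h(r).  The rim r = Rr,
   where the graph may be vertical, projects to a null set and is left out. *)
Definition sheet_integral (Rr : R) (h : R -> R) (phi : heis R n -> R) : \bar R :=
  (\int[lebesgue_tuple R n \x lebesgue_tuple R n]_(t in
      [set t | (radius (row_pair t) < Rr)%R])
    (let w := row_pair t in
     phi (w, h (radius w)) * area_density (h \o radius) w)%R%:E)%E.

Definition rot_integral (Rr : R) (hp hm : R -> R) (phi : heis R n -> R) :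
    \bar R :=
  (sheet_integral Rr hp phi + sheet_integral Rr hm phi)%E.

(* N q is a unit p-normal of the surface at q, for q off the axis and the rim
   (where the surface need not be smooth; both are null sets). *)
Definition pnormal_field (Rr : R) (hp hm : R -> R)
    (N : heis R n -> heis R n) : Prop :=
  forall q, rot_surface Rr hp hm q -> 0 < radius q.1 < Rr ->
    nonsingular (rot_surface Rr hp hm) q ->
    is_pnormal (rot_surface Rr hp hm) q (N q).

(* Projected p-area of the surface onto the orthogonal complement of the vector
   v at p, N being a field of unit p-normals of the surface. *)
Definition projected_area (Rr : R) (hp hm : R -> R)
    (N : heis R n -> heis R n) p v : \bar R :=
  rot_integral Rr hp hm (fun q => `|levi (push_left q p v) (N q)|).

End heisenberg.
Arguments rot_surface {R} n Rr hp hm.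

Section profiles.
Variable R : realType.

(* One-sided at the endpoints when A is an interval. *)
Definition deriv_within (A : set R) (h : R -> R) (r d : R) : Prop :=
  (h s - h r) / (s - r) @[s --> within (A `\ r) (nbhs r)] --> d.

Definition C1_profile (Rr : R) (h : R -> R) : Prop :=
  exists2 g : R -> R, {within `[0, Rr], continuous g} &
    forall r, 0 <= r <= Rr -> deriv_within `[0, Rr] h r (g r).

Definition bounded_profile (Rr : R) (h : R -> R) : Prop :=
  exists g : R -> R, forall r, 0 <= r < Rr ->
    deriv_within `[0, Rr] h r (g r) /\
    `|g r| <= r / Num.sqrt (Rr ^+ 2 - r ^+ 2).

Definition pansu_profile (lam r : R) : R :=
  (2 * lam ^+ 2)^-1 *
  (lam * r * Num.sqrt (1 - lam ^+ 2 * r ^+ 2) + acos (lam * r)).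

Definition Gamma (s : R) : R :=
  (\int[lebesgue_measure]_(t in `]0%R, +oo[) (t `^ (s - 1) * expR (- t)))%R.

Definition unit_ball_volume (m : nat) : \bar R :=
  lebesgue_tuple R m [set t | \sum_(i < m) tnth t i ^+ 2 <= 1].

End profiles.

Definition pansu_sphere (R : realType) (n : nat) (lam : R) : set (heis R n) :=
  rot_surface n lam^-1 (pansu_profile lam) (fun r => - pansu_profile lam r).
Arguments pansu_sphere {R} n lam.

(* Main.v *)
(** The integrand only depends on the horizontal parts of the vectors, and left
    translation does not change them: with r = |w|, a = h'(r) / r and J the
    rotation (x, y) |-> (-y, x), a sheet z = h(r) contributes the integral over
    the ball of |<v, a w + J w>|, for v a unit vector.

    Lebesgue measure on R^2n is invariant under rotations because a plane
    rotation is a product of three shears.  Invariance under w |-> c w + s J w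
    allows averaging over the plane spanned by v and J v, which replaces
    |<v, a w + J w>| by sqrt (a^2 + 1) |<v, w>|; invariance under the other
    rotations then makes the result independent of v.

    For the Pansu sphere sqrt (a^2 + 1) = 1 / sqrt (1 - lam^2 r^2).  On each
    line parallel to a coordinate axis, the integral of |x| / sqrt (rho^2 - x^2)
    is 2 rho, the length of the chord, so each sheet contributes the volume of
    the ball of radius 1 / lam of R^2n, up to the factor 1 / lam.  Volumes of
    balls are expressed with the Gamma function by integrating a Gaussian along
    its level sets. *)

From HB Require Import structures.
Require Import Defs.
From mathcomp Require Import all_boot all_order all_algebra.
From mathcomp Require Import all_classical all_reals all_analysis.
From mathcomp Require Import measurable_realfun ring lra.

Set Implicit Arguments.
Unset Strict Implicit.
Unset Printing Implicit Defensive.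

Import Order.TTheory GRing.Theory Num.Theory.
Import numFieldNormedType.Exports.

Local Open Scope classical_set_scope.
Local Open Scope ring_scope.

(* The analysis library has another [radius], of balls. *)
Local Notation radius := Defs.radius.

(** * Lebesgue measure on tuples *)

(** Polar coordinates are avoided. The average over the plane of v and J v is a Tonelli exchange
    with an auxiliary variable u in R^2; it produces a factor that is never computed, because the
    same identity is applied to the coefficients (a, 1) and to (sqrt (a^2 + 1), 0) and the two
    right-hand sides coincide. All integrands are nonnegative and all integrals are extended reals,
    so C is first an extended real, and its finiteness is a separate estimate that compares the
    slopes with a constant and with the density of the Pansu sphere of the same radius.

    The geometric obstacle is that the surface is a union of two graphs, so that a curve in it may
    jump between sheets where they meet. At an interior meeting point h- <= 0 <= h+ makes both
    heights vanish; one is then a minimum of h+ and the other a maximum of h-, both slopes are 0,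
    and the tangent space is still that of a single graph.

    The field N is only known to be p-normal off the axis and the rim. The integrand is therefore
    identified there, point by point, with an explicit measurable function. *)

Section affine.
Variable R : realType.
Local Notation mu := (@lebesgue_measure R).
Local Open Scope ereal_scope.

Lemma measurable_affine (k c : R) : measurable_fun [set: measurableTypeR R]
  ((fun x => k * x + c)%R : measurableTypeR R -> measurableTypeR R).
Proof. by apply: measurable_funD => //; exact: measurable_funM. Qed.

(** By uniqueness of Lebesgue measure: the rescaled pushforward gives half-open intervals their
    length. *)
Lemma lebesgue_measure_affine (k c : R) (A : set R) : (0 < k)%R ->
  measurable A ->
  mu A = k%:E * pushforward mu
    ((fun x => k * x + c)%R : measurableTypeR R -> measurableTypeR R) A.
Proof.
move=> k0 mA.
have kn : (0 <= k)%R by exact: ltW.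
have mphi := measurable_affine k c.
pose nu : {measure set (measurableTypeR R) -> \bar R} :=
  mscale (NngNum kn) (pushforward mu
    ((fun x => k * x + c)%R : measurableTypeR R -> measurableTypeR R)).
rewrite (@lebesgue_measure_unique R (nu mphi))//.
move=> _ [[a b]] _ <-; rewrite /nu /= /mscale/= /pushforward.
have -> : (fun x => k * x + c)%R @^-1` [set` `]a, b]] =
    [set` `](a - c) / k, (b - c) / k]]%R.
  apply/seteqP; split => x; rewrite /= !in_itv/= ltr_pdivrMr// ler_pdivlMr//;
  by rewrite ltrBlDr lerBrDr mulrC.
rewrite !lebesgue_measure_itv/= !lte_fin ltr_pM2r ?invr_gt0// ltrD2r.
case: ifPn => ab; last by rewrite mule0.
by rewrite !EFinN -!EFinD -EFinM; congr EFin; field; rewrite gt_eqF.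
Qed.

Lemma ge0_integral_affine (k c : R) (f : R -> \bar R) : (0 < k)%R ->
  measurable_fun setT f -> (forall x, 0 <= f x) ->
  \int[mu]_x f x = k%:E * \int[mu]_x f (k * x + c)%R.
Proof.
move=> k0 mf f0.
have kn : (0 <= k)%R by exact: ltW.
have mphi := measurable_affine k c.
pose nu : {measure set (measurableTypeR R) -> \bar R} :=
  mscale (NngNum kn) (pushforward mu
    ((fun x => k * x + c)%R : measurableTypeR R -> measurableTypeR R)).
transitivity (\int[nu mphi]_x f x).
  apply: eq_measure_integral => A mA _.
  by rewrite /nu/= /mscale/= (lebesgue_measure_affine c k0).
rewrite /nu ge0_integral_mscale//=; congr (_ * _).
by rewrite (ge0_integral_pushforward mphi)//= preimage_setT.
Qed.

End affine.

Section lebesgue_tuple_integral.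
Variable R : realType.
Local Notation mu := (@lebesgue_measure R).
Local Notation RT := (measurableTypeR R).
Local Open Scope ereal_scope.

Lemma ge0_integral_tuple_cons (m : nat) (f : m.+1.-tuple RT -> \bar R) :
  measurable_fun setT f -> (forall t, 0 <= f t) ->
  \int[lebesgue_tuple R m.+1]_t f t =
  \int[mu]_x \int[lebesgue_tuple R m]_t f (cons_pair (x, t)).
Proof.
move=> mf f0; have mc := @measurable_cons_pair R m.
transitivity (\int[mu \x lebesgue_tuple R m]_p f (cons_pair p)).
  by rewrite (ge0_integral_pushforward mc)//= preimage_setT.
by rewrite fubini_tonelli1//; exact: measurableT_comp.
Qed.

Definition tuple_affine (m : nat) (k : R) (c t : m.-tuple RT) : m.-tuple RT :=
  [tuple (k * tnth t i + tnth c i)%R | i < m].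

Lemma measurable_tuple_affine d (T : measurableType d) (m : nat) (k : R)
    (c t : T -> m.-tuple RT) :
  measurable_fun setT c -> measurable_fun setT t ->
  measurable_fun setT (fun x => tuple_affine k (c x) (t x)).
Proof.
move=> /measurable_fun_tnthP mc /measurable_fun_tnthP mt.
apply/measurable_fun_tnthP => i.
rewrite [X in measurable_fun _ X](_ : _ =
  (fun x => k * tnth (t x) i + tnth (c x) i)%R); last first.
  by apply/funext => x /=; rewrite tnth_mktuple.
by apply: measurable_funD; [apply: measurable_funM => //; exact: mt|exact: mc].
Qed.

Lemma tuple_affine_cons (m : nat) (k x : R) (c : m.+1.-tuple RT)
    (t : m.-tuple RT) :
  tuple_affine k c (cons_pair (x, t)) =
  cons_pair ((k * x + thead c)%R, tuple_affine k [tuple of behead c] t).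
Proof.
apply: eq_from_tnth => i; rewrite tnth_mktuple.
have [j ->|->] := unliftP ord0 i; last by rewrite !tnth0.
rewrite !tnthS !tnth_mktuple/= tnth_behead; congr (_ + tnth _ _)%R.
by apply/val_inj; rewrite /= inordK// ltnS ltn_ord.
Qed.

(** One formula serves two purposes: the factor [k] gives the homogeneity of ball volumes, and with
    k = 1 a shift [c] depending on the other half of a pair of tuples gives the invariance under
    shears. *)
Lemma ge0_integral_tuple_affine (m : nat) (k : R) (c : m.-tuple RT)
    (f : m.-tuple RT -> \bar R) : (0 < k)%R ->
  measurable_fun setT f -> (forall t, 0 <= f t) ->
  \int[lebesgue_tuple R m]_t f t =
  (k ^+ m)%:E * \int[lebesgue_tuple R m]_t f (tuple_affine k c t).
Proof.
move=> k0; elim: m c f => [|m IH] c f mf f0.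
  rewrite expr0 mul1e; apply: eq_integral => t _.
  by congr f; apply: eq_from_tnth => -[].
have mfa : measurable_fun setT (fun t => f (tuple_affine k c t)).
  apply: measurableT_comp => //.
  by apply: measurable_tuple_affine => //; exact: measurable_cst.
rewrite ge0_integral_tuple_cons// [in RHS]ge0_integral_tuple_cons//.
have mcons (x : R) : measurable_fun setT (fun t : m.-tuple RT => cons_pair (x, t)).
  apply: (measurableT_comp (@measurable_cons_pair R m)).
  exact: measurable_fun_pair.
rewrite (@ge0_integral_affine _ k (thead c))//; last 2 first.
- have mg : measurable_fun setT (f \o @cons_pair R m).
    by apply: measurableT_comp => //; exact: measurable_cons_pair.
  apply: (measurable_fun_fubini_tonelli_F _ mg) => p; exact: f0.
- by move=> x; exact: integral_ge0.
rewrite exprS EFinM -muleA; congr (_ * _).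
rewrite -ge0_integralZl//; last 3 first.
- have mg : measurable_fun setT
      ((fun t => f (tuple_affine k c t)) \o @cons_pair R m).
    by apply: measurableT_comp => //; exact: measurable_cons_pair.
  apply: (measurable_fun_fubini_tonelli_F _ mg) => p; exact: f0.
- by move=> x _; exact: integral_ge0.
- by rewrite lee_fin exprn_ge0// ltW.
apply: eq_integral => x _.
rewrite (IH [tuple of behead c])//; last exact: measurableT_comp.
by congr (_ * _); apply: eq_integral => t _; rewrite tuple_affine_cons.
Qed.

Lemma integral_tuple_gauss (m : nat) :
  \int[lebesgue_tuple R m]_t (expR (- \sum_(i < m) tnth t i ^+ 2)%R)%:E =
  (Num.sqrt pi ^+ m)%:E.
Proof.
have mE k : measurable_fun setT
    (fun t : k.-tuple RT => (expR (- \sum_(i < k) tnth t i ^+ 2)%R)%:E).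
  apply/measurable_EFinP; apply: measurableT_comp => //.
  apply: measurableT_comp => //; apply: measurable_sum => i.
  by apply: measurable_funX; exact: measurable_tnth.
elim: m => [|m IH].
  rewrite integral_dirac//; last exact: mE.
  by rewrite diracE mem_set// mul1e big_ord0 oppr0 expR0.
rewrite ge0_integral_tuple_cons//.
transitivity (\int[mu]_x ((Num.sqrt pi ^+ m)%:E * (gauss_fun x)%:E)).
  apply: eq_integral => x _; rewrite muleC -IH -ge0_integralZl//; last 2 first.
  - exact: mE.
  - by rewrite lee_fin expR_ge0.
  apply: eq_integral => t _; rewrite big_ord_recl tnth0 opprD expRD EFinM.
  by congr (_ * (expR (- _))%:E)%E; apply: eq_bigr => i _; rewrite tnthS.
rewrite ge0_integralZl//; last 2 first.
- by apply/measurable_EFinP; exact: measurable_gauss_fun.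
- by move=> x _; rewrite lee_fin gauss_fun_ge0.
by rewrite exprSr EFinM; congr (_ * _); exact: integralT_gauss.
Qed.

End lebesgue_tuple_integral.

(** * Layer cakes and volumes of balls *)

Section layer_cake.
Context {R : realType}.
Local Notation mu := (@lebesgue_measure R).
Local Notation RT := (measurableTypeR R).
Local Open Scope ereal_scope.

Lemma measurable_set_ler d (T : measurableType d) (f g : T -> R) :
  measurable_fun setT f -> measurable_fun setT g ->
  measurable [set x | (f x <= g x)%R].
Proof.
move=> mf mg; rewrite -[X in measurable X]setTI.
exact: (measurable_fun_ler mf mg measurableT (Y := [set true])).
Qed.

Lemma measurable_set_ltr d (T : measurableType d) (f g : T -> R) :
  measurable_fun setT f -> measurable_fun setT g ->
  measurable [set x | (f x < g x)%R].
Proof.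
move=> mf mg; rewrite -[X in measurable X]setTI.
exact: (measurable_fun_ltr mf mg measurableT (Y := [set true])).
Qed.

Lemma integral_expRN_ge (u : R) :
  \int[mu]_(s in `[u, +oo[) (expR (- s))%:E = (expR (- u))%:E.
Proof.
have dF (x : R) : is_derive x 1%R (fun y : R => - expR (- y))%R (expR (- x)).
  by apply: is_derive_eq; rewrite /GRing.scale/= mulrN1 opprK.
have cN (g : R -> R) (h : R -> R) : (forall x : R, is_derive x 1%R g (h x)) ->
    continuous g.
  move=> dg x; apply: differentiable_continuous; apply/derivable1_diffP.
  exact: ex_derive.
rewrite (@ge0_continuous_FTC2y _ _ (fun y : R => - expR (- y))%R u 0%R).
- by rewrite EFinN oppeK add0e.
- by move=> x _; exact: expR_ge0.
- apply: continuous_subspaceT => x; apply: continuous_comp.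
    exact: continuousN.
  exact: continuous_expR.
- by rewrite -oppr0; apply: cvgN; exact: cvgr_expR.
- by move=> x _; exact: ex_derive.
- by apply: cvg_at_right_filter; exact: (cN _ _ dF).
- by move=> x _; rewrite derive1E; exact: derive_val.
Qed.

(** Write exp (- q t) as the integral of exp (- s) over s >= q t and exchange the integrals: the
    inner one becomes the measure of a sublevel set of [q]. *)
Lemma integral_expRN_layer d (T : measurableType d)
    (nu : {sigma_finite_measure set T -> \bar R}) (q : T -> R) (k : R)
    (c : \bar R) : measurable_fun setT q -> (forall t, 0 <= q t)%R ->
  (forall s : R, (0 < s)%R -> nu [set t | q t <= s]%R = (s `^ k)%:E * c) ->
  0 <= c ->
  \int[nu]_t (expR (- q t))%:E =
  \int[mu]_(s in `]0%R, +oo[) (s `^ k * expR (- s))%:E * c.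
Proof.
move=> mq q0 nuq c0.
(* The condition 0 < s is added because sublevel measures are known only for positive levels. It
   changes the half-line s >= q t only when q t = 0, and then only by one point. *)
pose A : set (T * RT) := [set p | q p.1 <= p.2]%R `&` [set p | 0 < p.2]%R.
have mA : measurable A.
  apply: measurableI; [apply: measurable_set_ler|apply: measurable_set_ltr] => //.
  exact: measurableT_comp.
pose F (p : T * RT) := (\1_A p * expR (- p.2))%:E.
have mF : measurable_fun setT F.
  apply/measurable_EFinP; apply: measurable_funM => //.
  by apply: measurableT_comp => //; exact: measurableT_comp.
have F0 p : 0 <= F p by rewrite lee_fin mulr_ge0// expR_ge0.
transitivity (\int[nu \x mu]_p F p).
  rewrite fubini_tonelli1//; apply: eq_integral => t _; rewrite /fubini_F.
  rewrite -integral_expRN_ge -integral_itv_obnd_cbnd; last first.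
    by apply/measurable_EFinP/measurable_funTS; exact: measurableT_comp.
  have -> : \int[mu]_s F (t, s) =
      \int[mu]_(s in [set s | q t <= s /\ 0 < s]%R) (expR (- s))%:E.
    rewrite [RHS]integral_mkcond; apply: eq_integral => s _.
    rewrite /F /A /= patchE indicE.
    have [h|h] := boolP (_ \in _); have [h'|h'] := boolP (_ \in _).
    - by rewrite mul1r.
    - by exfalso; move/negP: h'; apply; move: h; rewrite !inE.
    - by exfalso; move/negP: h; apply; move: h'; rewrite !inE.
    - by rewrite mul0r.
  have := q0 t; rewrite le_eqVlt => /predU1P[<-|qt0].
    congr integral; apply/seteqP; split => s /=; rewrite in_itv/= andbT.
      by move=> s0; split=> //; exact: ltW.
    by case.
  rewrite integral_itv_obnd_cbnd; last first.
    by apply/measurable_EFinP/measurable_funTS; exact: measurableT_comp.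
  congr integral; apply/seteqP; split => s /=; rewrite in_itv/= andbT.
    by move=> s0; split=> //; exact: lt_le_trans s0.
  by case.
rewrite fubini_tonelli2// -ge0_integralZr//; last 2 first.
- apply/measurable_EFinP; apply: measurable_funM; last first.
    by apply/measurable_funTS; exact: measurableT_comp.
  by apply: measurable_funTS; exact: measurable_powR.
- by move=> s _; rewrite lee_fin mulr_ge0 ?powR_ge0 ?expR_ge0.
rewrite [RHS]integral_mkcond; apply: eq_integral => s _.
rewrite patchE /fubini_G /F mem_setE in_itv/= andbT.
case: ifPn => s0; last first.
  rewrite integral0_eq// => t _; rewrite indicE /A memNset ?mul0r//.
  by move=> [_ /=]; apply/negP.
under eq_integral do rewrite mulrC EFinM.
have mS : measurable [set t | q t <= s]%R by exact: measurable_set_ler.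
rewrite (_ : (fun t => _) = fun t =>
    (expR (- s))%:E * (\1_[set t | q t <= s]%R t)%:E); last first.
  apply/funext => t; congr (_ * _%:E); rewrite !indicE; congr (_%:R).
  by congr nat_of_bool; apply/idP/idP; rewrite !inE /A/=; [case|split].
rewrite ge0_integralZl ?lee_fin ?expR_ge0//; last first.
  by apply/measurable_EFinP; exact: measurable_indic.
rewrite integral_indic// setIT.
rewrite [X in _ * X](nuq s s0).
by rewrite muleA -EFinM mulrC.
Qed.

End layer_cake.

Section ball_volume.
Context {R : realType}.
Local Notation mu := (@lebesgue_measure R).
Local Notation RT := (measurableTypeR R).
Local Open Scope ereal_scope.

(** A positive finite product forces both factors to be positive and finite. This matters because
    [Gamma] is the [fine] part of an integral and a volume is a priori an extended real. *)
Lemma mule_fin_eq (a b : \bar R) (P : R) : 0 <= a -> 0 <= b -> (0 < P)%R ->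
  a * b = P%:E -> (0 < fine a)%R /\ b = (P / fine a)%:E.
Proof.
move=> + + P0; case: a => [a||]//=; case: b => [b||]//=.
- rewrite !lee_fin => a0 b0 [abP].
  have a1 : (0 < a)%R.
    rewrite lt_neqAle a0 andbT eq_sym; apply/eqP => az.
    by move: abP P0; rewrite az mul0r => <-; rewrite ltxx.
  by split => //; rewrite -abP mulrC mulKf// gt_eqF.
- rewrite lee_fin le_eqVlt => /predU1P[<-|a0] _.
    by rewrite mul0e => -[P0']; move: P0; rewrite -P0' ltxx.
  by rewrite gt0_muley// lte_fin.
- rewrite lee_fin => _; rewrite le_eqVlt => /predU1P[<-|b0].
    by rewrite mule0 => -[P0']; move: P0; rewrite -P0' ltxx.
  by rewrite gt0_mulye// lte_fin.
Qed.

(** With q the squared norm the left integral is Gaussian, which yields at once the volume [c] of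
    the unit ball and the convergence and positivity of the Gamma integral. *)
Lemma sublevel_measure_Gamma d (T : measurableType d)
    (nu : {sigma_finite_measure set T -> \bar R}) (q : T -> R) (k P : R)
    (c : \bar R) : measurable_fun setT q -> (forall t, 0 <= q t)%R ->
  (forall s : R, (0 < s)%R -> nu [set t | q t <= s]%R = (s `^ k)%:E * c) ->
  0 <= c -> (0 < P)%R ->
  \int[nu]_t (expR (- q t))%:E = P%:E ->
  (0 < Gamma (k + 1))%R /\ c = (P / Gamma (k + 1))%:E.
Proof.
move=> mq q0 nuq c0 P0; rewrite (integral_expRN_layer mq q0 nuq c0).
have -> : Gamma (k + 1) =
    fine (\int[mu]_(s in `]0%R, +oo[) (s `^ k * expR (- s))%:E).
  by rewrite /Gamma /Rintegral addrK.
apply: mule_fin_eq => //; apply: integral_ge0 => s _.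
by rewrite lee_fin mulr_ge0 ?powR_ge0 ?expR_ge0.
Qed.

Lemma sqrtr_exprn_powR (s : R) (m : nat) : (0 <= s)%R ->
  (Num.sqrt s ^+ m = s `^ (m%:R / 2))%R.
Proof.
move=> s0; rewrite -powR_mulrn ?sqrtr_ge0// -powR12_sqrt// -powRrM.
by rewrite mulrC.
Qed.

Lemma measurable_sumsqr (m : nat) : measurable_fun setT
  (fun t : m.-tuple RT => \sum_(i < m) tnth t i ^+ 2)%R.
Proof.
by apply: measurable_sum => i; apply: measurable_funX; exact: measurable_tnth.
Qed.

Lemma lebesgue_tuple_ball (m : nat) (s : R) : (0 < s)%R ->
  lebesgue_tuple R m [set t | \sum_(i < m) tnth t i ^+ 2 <= s]%R =
  (s `^ (m%:R / 2))%:E * unit_ball_volume R m.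
Proof.
move=> s0; have mB r : measurable
    [set t : m.-tuple RT | \sum_(i < m) tnth t i ^+ 2 <= r]%R.
  by apply: measurable_set_ler => //; exact: measurable_sumsqr.
have vE r : lebesgue_tuple R m [set t | \sum_(i < m) tnth t i ^+ 2 <= r]%R =
    \int[lebesgue_tuple R m]_t
      (\1_[set t : m.-tuple RT | \sum_(i < m) tnth t i ^+ 2 <= r]%R t)%:E.
  by rewrite integral_indic// setIT.
have sp : (0 < Num.sqrt s)%R by rewrite sqrtr_gt0.
rewrite vE (ge0_integral_tuple_affine [tuple 0%R | i < m] sp)//; last first.
  by apply/measurable_EFinP; exact: measurable_indic.
rewrite sqrtr_exprn_powR 1?ltW// /unit_ball_volume vE; congr (_ * _).
have E (t : m.-tuple RT) :
    (\sum_(i < m) tnth (tuple_affine (Num.sqrt s) [tuple 0 | i < m] t) i ^+ 2 =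
    s * \sum_(i < m) tnth t i ^+ 2)%R.
  rewrite mulr_sumr; apply: eq_bigr => i _.
  by rewrite !tnth_mktuple addr0 exprMn sqr_sqrtr// ltW.
apply: eq_integral => t _; rewrite !indicE; congr (_%:R)%:E.
congr nat_of_bool; apply/idP/idP; rewrite !inE /= E.
all: by rewrite -ler_pdivlMl// mulVf ?gt_eqF.
Qed.

Lemma unit_ball_volumeE (m : nat) :
  (0 < Gamma (m%:R / 2 + 1 : R))%R /\
  unit_ball_volume R m = (Num.sqrt pi ^+ m / Gamma (m%:R / 2 + 1))%:E.
Proof.
apply: (@sublevel_measure_Gamma _ _ (lebesgue_tuple R m)
  (fun t => \sum_(i < m) tnth t i ^+ 2)%R).
- exact: measurable_sumsqr.
- by move=> t; apply: sumr_ge0 => i _; exact: sqr_ge0.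
- by move=> s s0; exact: lebesgue_tuple_ball.
- exact: measure_ge0.
- by rewrite exprn_gt0// sqrtr_gt0 pi_gt0.
- exact: integral_tuple_gauss.
Qed.

End ball_volume.

(** * Integrals over pairs of row vectors *)

Section inner_product.
Context {R : realType} {n : nat}.
Local Notation V := ('rV[R]_n * 'rV[R]_n)%type.

Definition rdot (x y : 'rV[R]_n) : R := \sum_(j < n) x ord0 j * y ord0 j.

Lemma rdotC x y : rdot x y = rdot y x.
Proof. by apply: eq_bigr => j _; rewrite mulrC. Qed.

Lemma rdotDl x y z : rdot (x + y) z = rdot x z + rdot y z.
Proof. by rewrite -big_split; apply: eq_bigr => j _; rewrite mxE mulrDl. Qed.

Lemma rdotZl k x z : rdot (k *: x) z = k * rdot x z.
Proof. by rewrite mulr_sumr; apply: eq_bigr => j _; rewrite mxE mulrA. Qed.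

Lemma rdotNl x z : rdot (- x) z = - rdot x z.
Proof. by rewrite -scaleN1r rdotZl mulN1r. Qed.

Lemma rdotDr x y z : rdot z (x + y) = rdot z x + rdot z y.
Proof. by rewrite rdotC rdotDl !(rdotC z). Qed.

Lemma rdotZr k x z : rdot z (k *: x) = k * rdot z x.
Proof. by rewrite rdotC rdotZl (rdotC z). Qed.

Lemma rdotNr x z : rdot z (- x) = - rdot z x.
Proof. by rewrite rdotC rdotNl (rdotC z). Qed.

Definition rdotE :=
  (rdotDl, rdotDr, rdotNl, rdotNr, rdotZl, rdotZr).

Lemma rdot_ge0 x : 0 <= rdot x x.
Proof. by apply: sumr_ge0 => j _; rewrite -expr2 sqr_ge0. Qed.

Lemma rdot_eq0 x : (rdot x x == 0) = (x == 0).
Proof.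
apply/eqP/eqP => [|->]; last first.
  by rewrite /rdot big1// => j _; rewrite mxE mul0r.
move/eqP; rewrite psumr_eq0 => [/allP h|j _]; last by rewrite -expr2 sqr_ge0.
apply/rowP => j; have := h j; rewrite mem_index_enum => /(_ isT)/=.
by rewrite -expr2 sqrf_eq0 mxE => /eqP.
Qed.

Definition dot (u w : V) : R := rdot u.1 w.1 + rdot u.2 w.2.

Definition rotJ (w : V) : V := (- w.2, w.1).

Lemma dotC u w : dot u w = dot w u.
Proof. by rewrite /dot rdotC (rdotC u.2). Qed.

Lemma dotDl u v w : dot (u + v) w = dot u w + dot v w.
Proof. by rewrite /dot !rdotE addrACA. Qed.

Lemma dotDr u v w : dot w (u + v) = dot w u + dot w v.
Proof. by rewrite dotC dotDl !(dotC w). Qed.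

Lemma dotZl k u w : dot (k *: u) w = k * dot u w.
Proof. by rewrite /dot !rdotE mulrDr. Qed.

Lemma dotZr k u w : dot w (k *: u) = k * dot w u.
Proof. by rewrite dotC dotZl (dotC w). Qed.

Lemma dotJl u w : dot (rotJ u) w = - dot u (rotJ w).
Proof. by rewrite /dot /rotJ/= !rdotE; ring. Qed.

Lemma dotJJ u w : dot (rotJ u) (rotJ w) = dot u w.
Proof. by rewrite /dot /rotJ/= !rdotE; ring. Qed.

Lemma dotwJ w : dot w (rotJ w) = 0.
Proof. by rewrite /dot /rotJ/= !rdotE rdotC addNr. Qed.

Lemma dot_ge0 w : 0 <= dot w w.
Proof. by rewrite addr_ge0// rdot_ge0. Qed.

Lemma radiusE (w : V) : radius w = Num.sqrt (dot w w).
Proof.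
by rewrite /radius /dot /rdot -big_split; congr Num.sqrt; apply: eq_bigr.
Qed.

Lemma sqr_radius (w : V) : radius w ^+ 2 = dot w w.
Proof. by rewrite radiusE sqr_sqrtr// dot_ge0. Qed.

Lemma radius_ge0 (w : V) : 0 <= radius w.
Proof. exact: sqrtr_ge0. Qed.

Lemma leviE (p q : heis R n) : levi p q = dot p.1 q.1.
Proof. by rewrite /dot /rdot -big_split. Qed.

End inner_product.

Section product_sigma_finite.
Context d1 d2 (T1 : measurableType d1) (T2 : measurableType d2) (R : realType).
Variable m1 : {sigma_finite_measure set T1 -> \bar R}.
Variable m2 : {sigma_finite_measure set T2 -> \bar R}.

Lemma sigma_finite_product : sigma_finite setT (m1 \x m2)%E.
Proof.
have /sigma_finiteP[F [TF ndF Foo]] := sigma_finiteT m1.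
have /sigma_finiteP[G [TG ndG Goo]] := sigma_finiteT m2.
exists (fun k => F k `*` G k).
  rewrite -setXTT TF TG; apply/seteqP; split => -[x y] /=; last first.
    by move=> [i _ []]; split; exists i.
  move=> [[i _ Fx] [j _ Gy]]; exists (maxn i j) => //; split.
    by move: x Fx; exact/subsetPset/ndF/leq_maxl.
  by move: y Gy; exact/subsetPset/ndG/leq_maxr.
move=> k; have [mF Fk] := Foo k; have [mG Gk] := Goo k.
split; first exact: measurableX.
by rewrite product_measure1E// lte_mul_pinfty// ge0_fin_numE.
Qed.

(** The product measure is packed with its sigma-finiteness so that Tonelli applies again to a
    product of two such products, as in [rotor_average], and so that the layer-cake lemmas apply to
    it. *)
Definition sigma_finite_prod : {sigma_finite_measure set (T1 * T2)%type -> \bar R} :=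
  HB.pack (m1 \x m2)%E
    (Measure_isSigmaFinite.Build _ _ _ (m1 \x m2)%E sigma_finite_product).

End product_sigma_finite.

Definition pair_lebesgue (R : realType) n :=
  sigma_finite_prod (lebesgue_tuple R n) (lebesgue_tuple R n).

Section pair_integral.
Context {R : realType} {n : nat}.
Local Notation RT := (measurableTypeR R).
Local Notation V := ('rV[R]_n * 'rV[R]_n)%type.
Local Notation X := (n.-tuple RT * n.-tuple RT)%type.
Local Notation pm := (lebesgue_tuple R n \x lebesgue_tuple R n)%E.
Local Open Scope ereal_scope.

Lemma ge0_integral_pair_affine1 (k : R) (phi : n.-tuple RT -> n.-tuple RT)
    (f : X -> \bar R) : (0 < k)%R ->
  measurable_fun setT phi -> measurable_fun setT f -> (forall p, 0 <= f p) ->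
  \int[pm]_p f p =
  (k ^+ n)%:E * \int[pm]_p f (tuple_affine k (phi p.2) p.1, p.2).
Proof.
move=> k0 mphi mf f0.
have mg : measurable_fun setT (fun p : X => f (tuple_affine k (phi p.2) p.1, p.2)).
  apply: measurableT_comp => //; apply: measurable_fun_pair => //.
  by apply: measurable_tuple_affine => //; exact: measurableT_comp.
rewrite fubini_tonelli2// fubini_tonelli2// -ge0_integralZl//; last 3 first.
- exact: measurable_fun_fubini_tonelli_G.
- by move=> y _; exact: integral_ge0.
- by rewrite lee_fin exprn_ge0// ltW.
apply: eq_integral => y _; rewrite /fubini_G.
rewrite (ge0_integral_tuple_affine (phi y) k0)//.
by apply: measurableT_comp => //; exact: measurable_fun_pair.
Qed.

Lemma ge0_integral_pair_affine2 (k : R) (phi : n.-tuple RT -> n.-tuple RT)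
    (f : X -> \bar R) : (0 < k)%R ->
  measurable_fun setT phi -> measurable_fun setT f -> (forall p, 0 <= f p) ->
  \int[pm]_p f p =
  (k ^+ n)%:E * \int[pm]_p f (p.1, tuple_affine k (phi p.1) p.2).
Proof.
move=> k0 mphi mf f0.
have mg : measurable_fun setT (fun p : X => f (p.1, tuple_affine k (phi p.1) p.2)).
  apply: measurableT_comp => //; apply: measurable_fun_pair => //.
  by apply: measurable_tuple_affine => //; exact: measurableT_comp.
rewrite fubini_tonelli1// fubini_tonelli1// -ge0_integralZl//; last 3 first.
- exact: measurable_fun_fubini_tonelli_F.
- by move=> y _; exact: integral_ge0.
- by rewrite lee_fin exprn_ge0// ltW.
apply: eq_integral => x _; rewrite /fubini_F.
rewrite (ge0_integral_tuple_affine (phi x) k0)//.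
by apply: measurableT_comp => //; exact: measurable_fun_pair.
Qed.

Definition pair_measurable (f : V -> R) :=
  measurable_fun setT (f \o @row_pair R n).

Definition pair_integral (f : V -> R) : \bar R :=
  \int[pm]_t (f (row_pair t))%:E.

(** Measurability is tested on tuples through [row_pair]; preserving it is part of the notion, since
    otherwise two such maps could not be composed. *)
Definition pair_preserving (T : V -> V) := forall f,
  pair_measurable f -> (forall w, 0 <= f w)%R ->
  pair_measurable (f \o T) /\ pair_integral (f \o T) = pair_integral f.

Lemma pair_preserving_comp T U :
  pair_preserving T -> pair_preserving U -> pair_preserving (T \o U).
Proof.
move=> pT pU f mf f0; have [mfT IT] := pT f mf f0.
have [|mfU IU] := pU _ mfT; first by move=> w; exact: f0.
by split => //; rewrite -IT -IU.
Qed.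

Definition row_measurable (phi : 'rV[R]_n -> 'rV[R]_n) := forall j,
  measurable_fun setT
    (fun t : n.-tuple RT => phi (\row_i tnth t i) ord0 j : RT).

Lemma shear1_preserving (phi : 'rV[R]_n -> 'rV[R]_n) : row_measurable phi ->
  pair_preserving (fun w => (w.1 + phi w.2, w.2)%R).
Proof.
move=> mphi f mf f0.
pose psi (t : n.-tuple RT) : n.-tuple RT :=
  [tuple phi (\row_i tnth t i)%R ord0 j | j < n].
have mpsi : measurable_fun setT psi.
  apply/measurable_fun_tnthP => i; rewrite [X in measurable_fun _ X](_ : _ =
    fun t => phi (\row_i tnth t i)%R ord0 i); first exact: mphi.
  by apply/funext => t /=; rewrite tnth_mktuple.
have E (t : X) : ((row_pair t).1 + phi (row_pair t).2 =
    (row_pair (tuple_affine 1 (psi t.2) t.1, t.2)).1)%R.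
  by apply/rowP => j; rewrite !mxE !tnth_mktuple mul1r.
have Ef : (f \o (fun w => (w.1 + phi w.2, w.2)%R)) \o @row_pair R n =
    (f \o @row_pair R n) \o (fun t : X => (tuple_affine 1 (psi t.2) t.1, t.2)).
  by apply/funext => t /=; rewrite E.
split.
  rewrite /pair_measurable Ef; apply: measurableT_comp => //.
  apply: measurable_fun_pair => //.
  by apply: measurable_tuple_affine => //; exact: measurableT_comp.
rewrite /pair_integral [RHS](ge0_integral_pair_affine1 ltr01 mpsi)//; last 2 first.
- exact/measurable_EFinP.
- by move=> t; rewrite lee_fin.
rewrite expr1n mul1e; apply: eq_integral => t _; congr EFin.
exact: (congr1 (@^~ t) Ef).
Qed.

Lemma shear2_preserving (phi : 'rV[R]_n -> 'rV[R]_n) : row_measurable phi ->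
  pair_preserving (fun w => (w.1, w.2 + phi w.1)%R).
Proof.
move=> mphi f mf f0.
pose psi (t : n.-tuple RT) : n.-tuple RT :=
  [tuple phi (\row_i tnth t i)%R ord0 j | j < n].
have mpsi : measurable_fun setT psi.
  apply/measurable_fun_tnthP => i; rewrite [X in measurable_fun _ X](_ : _ =
    fun t => phi (\row_i tnth t i)%R ord0 i); first exact: mphi.
  by apply/funext => t /=; rewrite tnth_mktuple.
have E (t : X) : ((row_pair t).2 + phi (row_pair t).1 =
    (row_pair (t.1, tuple_affine 1 (psi t.1) t.2)).2)%R.
  by apply/rowP => j; rewrite !mxE !tnth_mktuple mul1r.
have Ef : (f \o (fun w => (w.1, w.2 + phi w.1)%R)) \o @row_pair R n =
    (f \o @row_pair R n) \o (fun t : X => (t.1, tuple_affine 1 (psi t.1) t.2)).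
  by apply/funext => t /=; rewrite E.
split.
  rewrite /pair_measurable Ef; apply: measurableT_comp => //.
  apply: measurable_fun_pair => //.
  by apply: measurable_tuple_affine => //; exact: measurableT_comp.
rewrite /pair_integral [RHS](ge0_integral_pair_affine2 ltr01 mpsi)//; last 2 first.
- exact/measurable_EFinP.
- by move=> t; rewrite lee_fin.
rewrite expr1n mul1e; apply: eq_integral => t _; congr EFin.
exact: (congr1 (@^~ t) Ef).
Qed.

End pair_integral.
Arguments pair_measurable {R} n f.
Arguments pair_integral {R} n f.

Section pair_measurability.
Context {R : realType} {n : nat}.
Local Notation RT := (measurableTypeR R).
Local Notation V := ('rV[R]_n * 'rV[R]_n)%type.
Local Notation X := (n.-tuple RT * n.-tuple RT)%type.
Local Notation pair_measurable := (@pair_measurable R n).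

Lemma pair_measurable_coord1 j : pair_measurable (fun w => w.1 ord0 j).
Proof.
rewrite /pair_measurable (_ : _ \o _ = (fun t : X => tnth t.1 j)).
  apply: (@measurableT_comp _ _ _ _ _ _ (fun x : n.-tuple RT => tnth x j)) => //.
  exact: measurable_tnth.
by apply/funext => t; rewrite /= mxE.
Qed.

Lemma pair_measurable_coord2 j : pair_measurable (fun w => w.2 ord0 j).
Proof.
rewrite /pair_measurable (_ : _ \o _ = (fun t : X => tnth t.2 j)).
  apply: (@measurableT_comp _ _ _ _ _ _ (fun x : n.-tuple RT => tnth x j)) => //.
  exact: measurable_tnth.
by apply/funext => t; rewrite /= mxE.
Qed.

Lemma pair_measurableM f g :
  pair_measurable f -> pair_measurable g -> pair_measurable (fun w => f w * g w).
Proof. by move=> mf mg; apply: measurable_funM. Qed.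

Lemma pair_measurableD f g :
  pair_measurable f -> pair_measurable g -> pair_measurable (fun w => f w + g w).
Proof. by move=> mf mg; apply: measurable_funD. Qed.

Lemma pair_measurable_sum m (f : 'I_m -> V -> R) :
  (forall i, pair_measurable (f i)) ->
  pair_measurable (fun w => \sum_(i < m) f i w).
Proof. by move=> mf; apply: measurable_sum => i; exact: mf. Qed.

Lemma pair_measurable_comp (h : R -> R) f : measurable_fun setT h ->
  pair_measurable f -> pair_measurable (fun w => h (f w)).
Proof. by move=> mh mf; apply: (measurableT_comp mh). Qed.

Lemma pair_measurable_cst (k : R) : pair_measurable (fun=> k).
Proof. exact: measurable_cst. Qed.

Lemma pair_measurable_norm f : pair_measurable f -> pair_measurable (fun w => `|f w|).
Proof. by move=> mf; apply: pair_measurable_comp. Qed.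

Lemma measurable_sqrtr : measurable_fun [set: R] Num.sqrt.
Proof. by apply: continuous_measurable_fun; exact: sqrt_continuous. Qed.

(** Real powers are measurable, but [powR_inv1] asks for a nonnegative base; hence x^-1 = x
    (x^2)^-1, which holds at 0 too, both sides being 0. *)
Lemma measurable_invr : measurable_fun [set: R] (@GRing.inv R).
Proof.
rewrite (_ : @GRing.inv R = fun x => x * (x ^+ 2) `^ (- 1)).
  apply: measurable_funM => //.
  apply: (measurableT_comp (measurable_powR (- 1))).
  exact: measurable_funX.
apply/funext => x; rewrite powR_inv1 ?sqr_ge0//.
have [->|x0] := eqVneq x 0; first by rewrite invr0 mul0r.
by rewrite expr2 invfM mulVKf.
Qed.

Lemma pair_measurable_dot v : pair_measurable (dot v).
Proof.
apply: pair_measurableD; apply: pair_measurable_sum => j.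
  apply: pair_measurableM; first exact: pair_measurable_cst.
  exact: pair_measurable_coord1.
apply: pair_measurableM; first exact: pair_measurable_cst.
exact: pair_measurable_coord2.
Qed.

Lemma pair_measurable_radius : pair_measurable (@Defs.radius R n).
Proof.
apply: (pair_measurable_comp measurable_sqrtr); apply: pair_measurable_sum => j.
apply: pair_measurableD; apply: measurable_funX.
  exact: pair_measurable_coord1.
exact: pair_measurable_coord2.
Qed.

Lemma pair_measurable_radial (g : R -> R) : measurable_fun setT g ->
  pair_measurable (fun w => g (radius w)).
Proof.
by move=> mg; apply: pair_measurable_comp => //; exact: pair_measurable_radius.
Qed.

Lemma ge0_pair_integralZl (k : R) f : pair_measurable f -> (forall w, 0 <= f w) ->
  0 <= k -> pair_integral n (fun w => k * f w) = (k%:E * pair_integral n f)%E.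
Proof.
move=> mf f0 k0; rewrite /pair_integral -ge0_integralZl_EFin//; last first.
  exact/measurable_EFinP.
by move=> t _; rewrite lee_fin.
Qed.

End pair_measurability.

(** * Rotations as products of shears *)

Section rotations.
Context {R : realType} {n : nat}.
Local Notation RT := (measurableTypeR R).
Local Notation V := ('rV[R]_n * 'rV[R]_n)%type.

Lemma row_measurable_scale (k : R) : row_measurable (fun x : 'rV[R]_n => k *: x).
Proof.
move=> j; under eq_fun do rewrite !mxE; apply: measurable_funM => //.
exact: measurable_tnth.
Qed.

Lemma row_measurable_rank1 (k : R) (a b : 'rV[R]_n) :
  row_measurable (fun x => (k * rdot x b) *: a).
Proof.
move=> j; under eq_fun do rewrite !mxE.
apply: measurable_funM => //; apply: measurable_funM => //.
apply: measurable_sum => i; under eq_fun do rewrite !mxE.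
by apply: measurable_funM => //; exact: measurable_tnth.
Qed.

(* A plane rotation of angle t is the product of three shears with coefficients
   - tan (t / 2), sin t, - tan (t / 2). *)
Lemma planar_rotation (a b : 'rV[R]_n) (c s : R) :
  rdot a a = 1 -> rdot b b = 1 -> c ^+ 2 + s ^+ 2 = 1 -> s != 0 ->
  exists2 T : V -> V, pair_preserving T &
    (forall w, radius (T w) = radius w) /\
    (forall p q w, dot (p *: a, q *: b) (T w) =
      dot ((p * c + q * s) *: a, (q * c - p * s) *: b) w).
Proof.
move=> aa bb cs s0; pose t := (1 - c) / s.
pose U (w : V) : V := (w.1 + (- t * rdot w.2 b) *: a, w.2).
pose L (w : V) : V := (w.1, w.2 + (s * rdot w.1 a) *: b).
have pU : pair_preserving U.
  exact: (shear1_preserving (row_measurable_rank1 _ _ _)).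
have pL : pair_preserving L.
  exact: (shear2_preserving (row_measurable_rank1 _ _ _)).
have ts : t * s = 1 - c by rewrite /t -mulrA mulVf// mulr1.
(* Half-angle identity: (1 - c) (1 + c) = s^2, divided by [s]. *)
have tc : t * (1 + c) = s.
  rewrite /t mulrAC; apply: (canLR (mulfK s0)); rewrite mulrC -expr2.
  by rewrite mulrC; move: cs; lra.
have TE w : (U \o (L \o U)) w =
    (w.1 + (- (1 - c) * rdot w.1 a - s * rdot w.2 b) *: a,
     w.2 + (s * rdot w.1 a - (1 - c) * rdot w.2 b) *: b).
  rewrite /U /L /= !rdotE aa bb; congr pair; last first.
    rewrite mulr1 mulrDr; congr (_ + _ *: _).
    by rewrite mulrA mulrN mulNr [s * t]mulrC ts.
  rewrite -addrA -scalerDl; congr (_ + _ *: _).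
  rewrite !mulr1; set x := rdot w.1 a; set y := rdot w.2 b.
  have -> : - t * y + - t * (y + s * (x + - t * y)) =
    - (t * s) * x - (t * (1 + (1 - t * s))) * y by ring.
  by rewrite ts subKr tc.
exists (U \o (L \o U)); first by do 2 (apply: pair_preserving_comp => //).
split=> [w|p q w].
  rewrite !radiusE; congr Num.sqrt; rewrite TE /dot /= !rdotE aa bb.
  rewrite !(rdotC a) !(rdotC b); set x := rdot w.1 a; set y := rdot w.2 b.
  by move: cs; nra.
rewrite TE /dot /= !rdotE aa bb (rdotC a) (rdotC b); ring.
Qed.

(** The same three shears, acting at once on all the planes of (x_j, y_j), which turn by one common
    angle. Since t = (1 - c) / s, the angle must have a nonzero sine. *)
Lemma rotJ_preserving (c s : R) : c ^+ 2 + s ^+ 2 = 1 -> s != 0 ->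
  pair_preserving (fun w : V => c *: w + s *: rotJ w).
Proof.
move=> cs s0; pose t := (1 - c) / s.
pose U (w : V) : V := (w.1 + (- t) *: w.2, w.2).
pose L (w : V) : V := (w.1, w.2 + s *: w.1).
have pU : pair_preserving U.
  exact: (shear1_preserving (row_measurable_scale _)).
have pL : pair_preserving L.
  exact: (shear2_preserving (row_measurable_scale _)).
have ts : t * s = 1 - c by rewrite /t -mulrA mulVf// mulr1.
have tc : t * (1 + c) = s.
  rewrite /t mulrAC; apply: (canLR (mulfK s0)); rewrite mulrC -expr2.
  by rewrite mulrC; move: cs; lra.
rewrite (_ : (fun w => _) = U \o (L \o U)).
  by do 2 (apply: pair_preserving_comp => //).
apply/funext => w; rewrite /U /L /=; congr pair => /=.
  apply/rowP => j; rewrite !mxE; set x := w.1 _ _; set y := w.2 _ _.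
  have -> : x + - t * y + - t * (y + s * (x + - t * y)) =
    (1 - t * s) * x - (t * (1 + (1 - t * s))) * y by ring.
  by rewrite ts subKr tc; ring.
apply/rowP => j; rewrite !mxE; set x := w.1 _ _; set y := w.2 _ _.
have -> : y + s * (x + - t * y) = (1 - t * s) * y + s * x by ring.
by rewrite ts; ring.
Qed.

End rotations.

(** * Integrals of radial functions *)

Section radial_integrals.
Context {R : realType}.
Local Notation RT := (measurableTypeR R).
Local Notation V n := ('rV[R]_n * 'rV[R]_n)%type.

Definition radial_integral n (g : R -> R) (v : V n) : \bar R :=
  pair_integral n (fun w => g (radius w) * `|dot v w|).

Section fixed_dimension.
Context {n : nat}.
Implicit Types (g : R -> R) (v : V n).

Lemma radial_integrand_measurable g v : measurable_fun setT g ->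
  pair_measurable n (fun w => g (radius w) * `|dot v w|).
Proof.
move=> mg; apply: pair_measurableM; first exact: pair_measurable_radial.
by apply: pair_measurable_norm; exact: pair_measurable_dot.
Qed.

Lemma radial_integralZ g k v : measurable_fun setT g -> (forall r, 0 <= g r) ->
  radial_integral g (k *: v) = (`|k|%:E * radial_integral g v)%E.
Proof.
move=> mg g0; rewrite -ge0_pair_integralZl//.
- by congr pair_integral; apply/funext => w; rewrite dotZl normrM mulrCA.
- exact: radial_integrand_measurable.
- by move=> w; rewrite mulr_ge0.
Qed.

Lemma scale_pairE (k : R) (x y : 'rV[R]_n) : k *: (x, y) = (k *: x, k *: y) :> V n.
Proof. by []. Qed.

Lemma radial_integral_planar g (a b : 'rV[R]_n) (c s p q : R) :
  measurable_fun setT g -> (forall r, 0 <= g r) ->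
  rdot a a = 1 -> rdot b b = 1 -> c ^+ 2 + s ^+ 2 = 1 -> s != 0 ->
  radial_integral g (p *: a, q *: b) =
  radial_integral g ((p * c + q * s) *: a, (q * c - p * s) *: b).
Proof.
move=> mg g0 aa bb cs s0.
have [T pT [rT dT]] := planar_rotation aa bb cs s0.
rewrite /radial_integral.
have [||_ <-] := pT (fun w => g (radius w) * `|dot (p *: a, q *: b) w|).
- exact: radial_integrand_measurable.
- by move=> w; rewrite mulr_ge0.
by congr pair_integral; apply/funext => w /=; rewrite rT dT.
Qed.

(** Turn by the angle of (p, q), with cosine p / rho and sine q / rho: this cancels the component
    along [b] and leaves rho along [a]. The case q = 0, where that sine vanishes, is pure
    scaling. *)
Lemma radial_integral_polar g (a b : 'rV[R]_n) (p q : R) :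
  measurable_fun setT g -> (forall r, 0 <= g r) ->
  rdot a a = 1 -> rdot b b = 1 ->
  radial_integral g (p *: a, q *: b) =
  ((Num.sqrt (p ^+ 2 + q ^+ 2))%:E * radial_integral g (a, 0%R))%E.
Proof.
move=> mg g0 aa bb; have [->|q0] := eqVneq q 0.
  rewrite scale0r expr0n/= addr0 sqrtr_sqr -radial_integralZ//.
  by congr radial_integral; rewrite scale_pairE scaler0.
pose rho := Num.sqrt (p ^+ 2 + q ^+ 2).
have pq : 0 < p ^+ 2 + q ^+ 2.
  by rewrite ltr_wpDl ?sqr_ge0// lt_neqAle sqr_ge0 eq_sym sqrf_eq0 q0.
have r0 : rho != 0 by rewrite gt_eqF// sqrtr_gt0.
have rr : rho ^+ 2 = p ^+ 2 + q ^+ 2 by rewrite sqr_sqrtr// ltW.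
rewrite (@radial_integral_planar g a b (p / rho) (q / rho))//; last 2 first.
- by rewrite !expr_div_n rr -mulrDl divff// gt_eqF.
- by rewrite mulf_neq0// invr_eq0.
rewrite -/rho -[in RHS](ger0_norm (sqrtr_ge0 _ : 0 <= rho)) -radial_integralZ//.
congr radial_integral; rewrite scale_pairE scaler0; congr (_ *: _, _).
  by rewrite !mulrA -mulrDl -!expr2 -rr expr2 mulfK.
by rewrite [X in X *: _](_ : _ = 0) ?scale0r//; ring.
Qed.

(** The given unit vector [e] serves as the direction when x = 0. *)
Lemma row_polar (e x : 'rV[R]_n) : rdot e e = 1 ->
  exists2 a, rdot a a = 1 & x = Num.sqrt (rdot x x) *: a.
Proof.
move=> ee; have [x0|x0] := eqVneq (rdot x x) 0.
  exists e => //; rewrite x0 sqrtr0 scale0r.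
  by apply/eqP; rewrite -rdot_eq0 x0.
have s0 : Num.sqrt (rdot x x) != 0.
  by rewrite sqrtr_eq0 -ltNge lt_neqAle eq_sym x0 rdot_ge0.
exists ((Num.sqrt (rdot x x))^-1 *: x); last by rewrite scalerA divff// scale1r.
rewrite !rdotE -{3}[rdot x x]sqr_sqrtr ?rdot_ge0// expr2.
by rewrite mulKf// mulVf.
Qed.

Lemma radial_integralE g (e : 'rV[R]_n) v :
  measurable_fun setT g -> (forall r, 0 <= g r) -> rdot e e = 1 ->
  radial_integral g v = ((radius v)%:E * radial_integral g (e, 0%R))%E.
Proof.
move=> mg g0 ee; case: v => x y.
have [a aa xE] := row_polar x ee; have [b bb yE] := row_polar y ee.
rewrite radiusE /dot /= {1}xE {1}yE radial_integral_polar//.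
rewrite !sqr_sqrtr ?rdot_ge0//; congr (_ * _)%E.
(* The available rotations only mix an x-direction with a y-direction. Two unit vectors (a, 0) and
   (e, 0) are therefore compared through (0, e), a quarter turn away from each. *)
have swap (u : 'rV[R]_n) : rdot u u = 1 ->
    radial_integral g (u, 0) = radial_integral g (0, e).
  move=> uu; rewrite -[in RHS](scale1r e) -[X in (X, _ *: _)](scale0r u).
  have c01 : 0 ^+ 2 + 1 ^+ 2 = 1 :> R by rewrite expr0n/= add0r expr1n.
  rewrite (@radial_integral_planar g u e 0 1 0 1 mg g0 uu ee c01 (oner_neq0 R)).
  by rewrite !mul0r !mulr0 mulr1 add0r subr0 scale1r scale0r.
by rewrite (swap a aa) (swap e ee).
Qed.

(** Needed because the weights h'(r) / r and exp (- r^2) / r say nothing at r = 0. For n = 0 the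
    origin would carry the whole Dirac mass. *)
Lemma pair_null_origin (hn : (0 < n)%N) :
  (lebesgue_tuple R n \x lebesgue_tuple R n)%E
    [set t | radius (row_pair t) = 0] = 0%E.
Proof.
pose B := [set t : n.-tuple RT | forall i, [set 0 : RT] (tnth t i)].
have mB : measurable B.
  rewrite [X in measurable X](_ : _ =
      \big[setI/setT]_(i < n) ((fun t => tnth t i) @^-1` [set 0 : RT])).
    apply: bigsetI_measurable => i _.
    by rewrite -[X in measurable X]setTI; exact: measurable_tnth.
  rewrite -bigcap_seq; apply/seteqP; split => t /= h; first by move=> i _; exact: h.
  by move=> i; apply: h; rewrite /= mem_index_enum.
have -> : [set t | radius (row_pair t) = 0] = B `*` B
    :> set (n.-tuple RT * n.-tuple RT).
  apply/seteqP; split => -[t u] /=.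
    rewrite radiusE => /eqP; rewrite sqrtr_eq0 => h.
    have : dot (row_pair (t, u)) (row_pair (t, u)) == 0 by rewrite eq_le h dot_ge0.
    rewrite paddr_eq0 ?rdot_ge0// !rdot_eq0 => /andP[/eqP /rowP tE /eqP /rowP uE].
    by split => i; [have := tE i|have := uE i]; rewrite !mxE.
  move=> [tB uB]; rewrite radiusE /dot [X in X + _](_ : _ = 0).
    rewrite [X in _ + X](_ : _ = 0) ?addr0 ?sqrtr0//.
    by rewrite /rdot big1// => j _; rewrite !mxE (uB j) mul0r.
  by rewrite /rdot big1// => j _; rewrite !mxE (tB j) mul0r.
rewrite product_measure1E// [X in (X * _)%E](_ : _ = 0%E) ?mul0e//.
transitivity (\prod_(i < n) lebesgue_measure [set (0 : R)%R])%E.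
  by apply: (@lebesgue_tuple_box R n (fun=> [set 0])) => i; exact: measurable_set1.
by rewrite (bigD1 (Ordinal hn))//= lebesgue_measure_set1 mul0e.
Qed.

End fixed_dimension.
End radial_integrals.

(** * Averaging over the plane of v and J v *)

Section rotation_average.
Context {R : realType}.
Local Notation RT := (measurableTypeR R).
Local Notation V n := ('rV[R]_n * 'rV[R]_n)%type.
Local Notation X n := (n.-tuple RT * n.-tuple RT)%type.
Local Notation pm n := (lebesgue_tuple R n \x lebesgue_tuple R n)%E.

Lemma pair_integral_gauss n :
  pair_integral n (fun w : V n => expR (- radius w ^+ 2)) =
  (Num.sqrt pi ^+ (2 * n))%:E.
Proof.
have E (t : X n) : (expR (- radius (row_pair t) ^+ 2))%:E =
    ((expR (- \sum_(i < n) tnth t.1 i ^+ 2))%:E *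
     (expR (- \sum_(i < n) tnth t.2 i ^+ 2))%:E)%E.
  rewrite sqr_radius /dot opprD expRD EFinM; congr (_ * _)%E; congr (expR (- _))%:E.
    by apply: eq_bigr => i _; rewrite !mxE -expr2.
  by apply: eq_bigr => i _; rewrite !mxE -expr2.
have mE (k : nat) : measurable_fun setT
    (fun t : k.-tuple RT => (expR (- \sum_(i < k) tnth t i ^+ 2))%:E).
  apply/measurable_EFinP; apply: measurableT_comp => //.
  by apply: measurableT_comp => //; exact: measurable_sumsqr.
have mG : pair_measurable n (fun w : V n => expR (- radius w ^+ 2)).
  apply: (@pair_measurable_radial R n (fun r => expR (- r ^+ 2))).
  by apply: measurableT_comp => //; apply: measurableT_comp.
rewrite /pair_integral fubini_tonelli1//; last exact/measurable_EFinP.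
transitivity (\int[lebesgue_tuple R n]_x
  ((expR (- \sum_(i < n) tnth x i ^+ 2))%:E * (Num.sqrt pi ^+ n)%:E))%E.
  apply: eq_integral => x _; rewrite /fubini_F; under eq_integral do rewrite E/=.
  rewrite ge0_integralZl ?lee_fin ?expR_ge0//; last exact: mE.
  by rewrite integral_tuple_gauss.
rewrite ge0_integralZr ?lee_fin ?exprn_ge0 ?sqrtr_ge0//; last exact: mE.
by rewrite integral_tuple_gauss -EFinM -exprD addnn mul2n.
Qed.

Section rotor.
Context {n : nat}.
Implicit Types (v w : V n) (al be : R -> R).

(* <v, al(|w|) w + be(|w|) J w> *)
Definition rotor al be v w : R :=
  al (radius w) * dot v w - be (radius w) * dot (rotJ v) w.

Definition rotor_integral al be v : \bar R :=
  pair_integral n (fun w => `|rotor al be v w|).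

Lemma rotJK v : rotJ (rotJ v) = - v.
Proof. by case: v. Qed.

Lemma dotNl v w : dot (- v) w = - dot v w.
Proof. by rewrite -scaleN1r dotZl mulN1r. Qed.

Lemma pair_measurable_rotor al be v : measurable_fun setT al ->
  measurable_fun setT be -> pair_measurable n (rotor al be v).
Proof.
move=> mal mbe; rewrite /rotor.
apply: measurable_funB; apply: measurable_funM.
- exact: pair_measurable_radial.
- exact: pair_measurable_dot.
- exact: pair_measurable_radial.
- exact: pair_measurable_dot.
Qed.

Lemma rotorD al be (c s : R) v w :
  rotor al be (c *: v + s *: rotJ v) w =
  c * rotor al be v w + s * rotor al be (rotJ v) w.
Proof.
have JE : rotJ (c *: v + s *: rotJ v) = c *: rotJ v - s *: v.
  by rewrite /rotJ; congr pair; apply/rowP => j; rewrite !mxE; ring.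
rewrite /rotor JE !dotDl rotJK !dotNl !dotZl; ring.
Qed.

Lemma radius_rotJ (c s : R) w : c ^+ 2 + s ^+ 2 = 1 ->
  radius (c *: w + s *: rotJ w) = radius w.
Proof.
move=> cs; rewrite !radiusE !(dotDl, dotDr, dotZl, dotZr) dotJl dotJJ.
rewrite (dotwJ w); congr Num.sqrt.
by rewrite -[RHS]mul1r -cs; ring.
Qed.

(** [w |-> al w + be J w] commutes with c + s J, so the rotation of [w] passes to [v] as its adjoint
    c - s J. *)
Lemma rotor_rotJ al be (c s : R) v w : c ^+ 2 + s ^+ 2 = 1 ->
  rotor al be v (c *: w + s *: rotJ w) = rotor al be (c *: v - s *: rotJ v) w.
Proof.
move=> cs; rewrite -scaleNr rotorD /rotor radius_rotJ// !(dotDr, dotZr).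
have -> : dot v (rotJ w) = - dot (rotJ v) w by rewrite dotJl opprK.
by rewrite dotJJ rotJK dotNl; ring.
Qed.

Lemma rotor_integralZ al be (k : R) v : measurable_fun setT al ->
  measurable_fun setT be ->
  rotor_integral al be (k *: v) = (`|k|%:E * rotor_integral al be v)%E.
Proof.
move=> mal mbe; rewrite -ge0_pair_integralZl//; last first.
  by apply: pair_measurable_norm; exact: pair_measurable_rotor.
congr pair_integral; apply/funext => w; rewrite -normrM; congr `|_|.
have -> : k *: v = k *: v + 0 *: rotJ v by rewrite scale0r addr0.
by rewrite rotorD mul0r addr0.
Qed.

(** c + s J is rho times a rotation, which the integral does not see; only the factor rho
    survives. *)
Lemma rotor_integral_rotJ al be (c s : R) v : measurable_fun setT al ->
  measurable_fun setT be ->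
  rotor_integral al be (c *: v + s *: rotJ v) =
  ((Num.sqrt (c ^+ 2 + s ^+ 2))%:E * rotor_integral al be v)%E.
Proof.
move=> mal mbe; have [->|s0] := eqVneq s 0.
  by rewrite expr0n/= addr0 scale0r addr0 sqrtr_sqr rotor_integralZ.
pose rho := Num.sqrt (c ^+ 2 + s ^+ 2).
have cs : 0 < c ^+ 2 + s ^+ 2.
  by rewrite ltr_wpDl ?sqr_ge0// lt_neqAle sqr_ge0 eq_sym sqrf_eq0 s0.
have r0 : rho != 0 by rewrite gt_eqF// sqrtr_gt0.
have rr : rho ^+ 2 = c ^+ 2 + s ^+ 2 by rewrite sqr_sqrtr// ltW.
have cs1 : (c / rho) ^+ 2 + (- (s / rho)) ^+ 2 = 1.
  by rewrite sqrrN !expr_div_n rr -mulrDl divff// gt_eqF.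
have -> : c *: v + s *: rotJ v = rho *: ((c / rho) *: v - (- (s / rho)) *: rotJ v).
  by rewrite scaleNr opprK scalerDr !scalerA ![rho * _]mulrC !divfK.
rewrite rotor_integralZ// ger0_norm ?sqrtr_ge0//; congr (_ * _)%E.
rewrite /rotor_integral.
have ns0 : - (s / rho) != 0 by rewrite oppr_eq0 mulf_neq0// invr_eq0.
have [||_ <-] := rotJ_preserving cs1 ns0 (f := fun w => `|rotor al be v w|).
- by apply: pair_measurable_norm; exact: pair_measurable_rotor.
- by [].
by congr pair_integral; apply/funext => w /=; rewrite rotor_rotJ.
Qed.

(** The absolute value makes the weight nonnegative for every real argument, as the lemmas on radial
    integrals require. *)
Let g1 (r : R) : R := expR (- r ^+ 2) / `|r|.

Let mg1 : measurable_fun setT g1.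
Proof.
apply: measurable_funM; last first.
  by apply: (measurableT_comp measurable_invr); exact: normr_measurable.
by apply: measurableT_comp => //; apply: measurableT_comp.
Qed.

Let g1_ge0 r : 0 <= g1 r.
Proof. by rewrite divr_ge0// expR_ge0. Qed.

(* Integrate g1(|u|) |<u_1 v + u_2 J v, al w + be J w>| over u in R^2 and w, in
   both orders.  The weight g1 makes the integral of g1(|u|) |u| Gaussian. *)
Lemma rotor_average al be v : measurable_fun setT al -> measurable_fun setT be ->
  (pi%:E * rotor_integral al be v =
  radial_integral (n := 1) g1 (const_mx 1%R, 0%R) *
  pair_integral n (fun w => Num.sqrt ((al (radius w) ^+ 2 + be (radius w) ^+ 2) *
    (dot v w ^+ 2 + dot (rotJ v) w ^+ 2))))%E.
Proof.
move=> mal mbe.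
pose A w := rotor al be v w; pose B w := rotor al be (rotJ v) w.
have mA : pair_measurable n A by exact: pair_measurable_rotor.
have mB : pair_measurable n B by exact: pair_measurable_rotor.
pose F (p : X 1 * X n) := (g1 (radius (row_pair p.1)) *
  `|(row_pair p.1).1 ord0 ord0 * A (row_pair p.2) +
    (row_pair p.1).2 ord0 ord0 * B (row_pair p.2)|)%:E.
have F0 p : (0 <= F p)%E by rewrite lee_fin mulr_ge0// g1_ge0.
have mF : measurable_fun setT F.
  apply/measurable_EFinP; apply: measurable_funM.
    exact: (measurableT_comp (pair_measurable_radial mg1)).
  apply: measurableT_comp => //; apply: measurable_funD; apply: measurable_funM.
  - exact: (measurableT_comp (pair_measurable_coord1 _)).
  - exact: (measurableT_comp mA).
  - exact: (measurableT_comp (pair_measurable_coord2 _)).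
  - exact: (measurableT_comp mB).
have G0 : (0 <= rotor_integral al be v)%E.
  by apply: integral_ge0 => t _; rewrite lee_fin.
pose m1 := pair_lebesgue R 1; pose m2 := pair_lebesgue R n.
transitivity (\int[m1 \x m2]_p F p)%E; last first.
  rewrite (@fubini_tonelli2 _ _ _ _ _ m1 m2)//.
  transitivity (\int[pm n]_s
    ((Num.sqrt (A (row_pair s) ^+ 2 + B (row_pair s) ^+ 2))%:E *
      radial_integral (n := 1) g1 (const_mx 1%R, 0%R)))%E.
    apply: eq_integral => s _; rewrite /fubini_G.
    (* For fixed w the integral over u is a radial integral in R^2 against the vector (A, B), so it
       is the length of (A, B) times a constant. *)
    pose u0 : V 1 := (const_mx (A (row_pair s)), const_mx (B (row_pair s))).
    have r0 : radius u0 = Num.sqrt (A (row_pair s) ^+ 2 + B (row_pair s) ^+ 2).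
      by rewrite radiusE /dot /rdot !big_ord1 !mxE -!expr2.
    rewrite -r0 -radial_integralE//; last by rewrite /rdot big_ord1 !mxE mulr1.
    apply: eq_integral => t _; rewrite /F /= /dot /rdot !big_ord1 /u0 /= !mxE.
    by rewrite [A _ * _]mulrC [B _ * _]mulrC.
  rewrite ge0_integralZr//; last 2 first.
  - apply/measurable_EFinP; apply: measurableT_comp; first exact: measurable_sqrtr.
    by apply: measurable_funD; exact: measurable_funX.
  - by apply: integral_ge0 => t _; rewrite lee_fin mulr_ge0// g1_ge0.
  rewrite muleC; congr (_ * _)%E; apply: eq_integral => s _; congr (Num.sqrt _)%:E.
  (* Two-squares identity: with p = <v, w> and q = <J v, w>, A = al p - be q and B = al q + be p, so
     A^2 + B^2 = (al^2 + be^2) (p^2 + q^2). *)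
  by rewrite /A /B /rotor rotJK dotNl; ring.
rewrite (@fubini_tonelli1 _ _ _ _ _ m1 m2)//.
transitivity (\int[pm 1]_t ((expR (- radius (row_pair t) ^+ 2))%:E *
    rotor_integral al be v))%E.
  rewrite ge0_integralZr//; last first.
    apply/measurable_EFinP.
    apply: (@pair_measurable_radial R 1 (fun r => expR (- r ^+ 2))).
    by apply: measurableT_comp => //; apply: measurableT_comp.
  congr (_ * _)%E; have := pair_integral_gauss 1.
  by rewrite muln1 sqr_sqrtr ?pi_ge0// => <-.
have mL : measurable_fun setT (fun t : X 1 =>
    ((expR (- radius (row_pair t) ^+ 2))%:E * rotor_integral al be v)%E).
  apply: emeasurable_funM => //; apply/measurable_EFinP.
  apply: (@pair_measurable_radial R 1 (fun r => expR (- r ^+ 2))).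
  by apply: measurableT_comp => //; apply: measurableT_comp.
apply: ae_eq_integral => //.
  exact: (measurable_fun_fubini_tonelli_F (m2 := m2) _ mF F0).
(* At u = 0 the Gaussian is 1 while [g1] is 0, so the integrands are compared off the origin
   only. *)
exists [set t : X 1 | radius (row_pair t) = 0]; split.
- rewrite (_ : [set t | _] = [set t | radius (row_pair t) <= 0]).
    by apply: measurable_set_ler => //; exact: pair_measurable_radius.
  apply/seteqP; split => t /=; first by move=> ->.
  by move=> h; apply/eqP; rewrite eq_le h radius_ge0.
- exact: pair_null_origin.
move=> t /= /not_implyP[_]; apply: contra_notP => /eqP r0.
set u := row_pair t; rewrite /fubini_F /F /= -/u.
rewrite -[LHS](_ : (g1 (radius u))%:E *
    ((radius u)%:E * rotor_integral al be v) = _)%E; last first.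
  by rewrite muleA -EFinM /g1 ger0_norm ?radius_ge0// divfK.
rewrite -[in LHS](_ : Num.sqrt (u.1 ord0 ord0 ^+ 2 + u.2 ord0 ord0 ^+ 2) =
    radius u); last first.
  by rewrite /Defs.radius big_ord1.
rewrite -rotor_integral_rotJ// -ge0_pair_integralZl//.
- rewrite /pair_integral; apply: eq_integral => s _ /=; rewrite rotorD -/u.
  by rewrite [radius u]/Defs.radius big_ord1 /=.
- by apply: pair_measurable_norm; exact: pair_measurable_rotor.
Qed.

(** The right-hand side of [rotor_average] depends on [al] and [be] only through al^2 + be^2, so
    (al, be) may be replaced by (sqrt (al^2 + be^2), 0); the positive factor pi is then
    cancelled. *)
Lemma rotor_integralE al be v : measurable_fun setT al ->
  measurable_fun setT be ->
  rotor_integral al be v =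
  radial_integral (fun r => Num.sqrt (al r ^+ 2 + be r ^+ 2)) v.
Proof.
move=> mal mbe; pose ga r := Num.sqrt (al r ^+ 2 + be r ^+ 2).
have mga : measurable_fun setT ga.
  apply: measurableT_comp; first exact: measurable_sqrtr.
  by apply: measurable_funD; exact: measurable_funX.
transitivity (rotor_integral ga (cst 0) v); last first.
  congr pair_integral; apply/funext => w; rewrite /rotor /= mul0r subr0 normrM.
  by rewrite ger0_norm// sqrtr_ge0.
have pi0 : pi != 0 :> R by rewrite gt_eqF// pi_gt0.
have piK (a b : \bar R) : (pi%:E * a = pi%:E * b -> a = b)%E.
  move=> ab; rewrite -[a]mul1e -[b]mul1e -(mulVf pi0) EFinM -!muleA ab.
  by [].
apply: piK; rewrite !rotor_average//.
congr (_ * pair_integral _ _)%E; apply/funext => w.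
by rewrite /= expr0n/= addr0 sqr_sqrtr// addr_ge0// sqr_ge0.
Qed.

End rotor.
End rotation_average.

(** * The density of the Pansu sphere *)

Section cap_integral.
Context {R : realType}.
Local Notation mu := (@lebesgue_measure R).
Local Notation RT := (measurableTypeR R).

Lemma is_derive_sqrt_cap (rho x : R) : 0 < rho ^+ 2 - x ^+ 2 ->
  is_derive x 1 (fun y : R => - Num.sqrt (rho ^+ 2 - y ^+ 2))
    (x / Num.sqrt (rho ^+ 2 - x ^+ 2)).
Proof.
move=> h.
have d1 : is_derive x 1 (fun y : R => rho ^+ 2 - y ^+ 2) (- (x *+ 2)).
  apply: is_derive_eq.
  by rewrite add0r mul1r /GRing.scale/= mulr1 mulr2n.
have d2 : is_derive x 1 (Num.sqrt \o (fun y : R => rho ^+ 2 - y ^+ 2))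
    ((2 * Num.sqrt (rho ^+ 2 - x ^+ 2))^-1 * - (x *+ 2)).
  by apply: is_derive1_comp; apply: is_derive1_sqrt.
have d3 := is_deriveN d2.
apply: (is_derive_eq d3).
have s0 : Num.sqrt (rho ^+ 2 - x ^+ 2) != 0 by rewrite gt_eqF// sqrtr_gt0.
by rewrite mulrN opprK -mulr_natl; field; rewrite s0.
Qed.

Lemma measurable_cap (rho : R) : measurable_fun [set: R]
  (fun x => x / Num.sqrt (rho ^+ 2 - x ^+ 2)).
Proof.
apply: measurable_funM => //; apply: (measurableT_comp measurable_invr).
by apply: (measurableT_comp measurable_sqrtr); apply: measurable_funB.
Qed.

Lemma integral_cap0y (rho : R) : 0 < rho ->
  (\int[mu]_(x in `[0%R, +oo[) (x / Num.sqrt (rho ^+ 2 - x ^+ 2))%:E = rho%:E)%E.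
Proof.
move=> rho0.
(* The integrand blows up at rho, so [0, rho) is exhausted by intervals [0, r i], with r i chosen
   such that rho^2 - (r i)^2 = (rho / (i + 1))^2. The antiderivative - sqrt (rho^2 - x^2) then gives
   exactly rho - rho / (i + 1). *)
pose r i : R := rho * Num.sqrt (1 - (@harmonic R i) ^+ 2).
pose F i : set R := `[0, r i]%classic.
have h1 i : 0 < (@harmonic R i) ^+ 2 <= 1.
  rewrite exprn_gt0 ?harmonic_gt0//= exprn_ile1 ?harmonic_ge0//=.
  by rewrite invf_le1 ?ltr0n// ler1n.
have r0 i : 0 <= r i by rewrite mulr_ge0 ?sqrtr_ge0// ltW.
have rE i : rho ^+ 2 - r i ^+ 2 = (rho * @harmonic R i) ^+ 2.
  rewrite /r !exprMn sqr_sqrtr ?subr_ge0; last by case/andP: (h1 i).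
  by rewrite mulrBr mulr1 subKr.
have ltr i x : 0 <= x <= r i -> 0 < rho ^+ 2 - x ^+ 2.
  move=> /andP[x0 xr]; rewrite (@lt_le_trans _ _ (rho ^+ 2 - r i ^+ 2))//.
    by rewrite rE exprn_gt0// mulr_gt0// harmonic_gt0.
  by rewrite lerD2l lerN2 ler_sqr ?nnegrE.
have ndr : {homo r : i j / (i <= j)%N >-> i <= j}.
  move=> i j ij; rewrite ler_pM2l// ler_wsqrtr// lerD2l lerN2.
  rewrite ler_sqr ?nnegrE ?harmonic_ge0//=.
  by rewrite lef_pV2 ?posrE ?ltr0n// ler_nat.
have UF : \bigcup_i F i = `[0, rho[%classic.
  apply/seteqP; split => x /=; rewrite in_itv/=.
    move=> [i _]; rewrite /F /= in_itv/= => /[dup] /andP[x0 _] /ltr.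
    by rewrite x0 subr_gt0 ltr_sqr// nnegrE ltW.
  move=> /andP[x0 xrho].
  pose e := Num.sqrt (rho ^+ 2 - x ^+ 2) / rho.
  have d0 : 0 < rho ^+ 2 - x ^+ 2 by rewrite subr_gt0 ltr_sqr ?nnegrE// ltW.
  have e0 : 0 < e by rewrite divr_gt0// sqrtr_gt0.
  have [i ie] : exists i, @harmonic R i < e.
    have := @cvg_harmonic R => /cvgrPdist_lt /(_ _ e0) [i _ /(_ i (leqnn i))].
    by rewrite sub0r normrN ger0_norm ?harmonic_ge0// => ?; exists i.
  exists i => //; rewrite /F /= in_itv/= x0/= -ler_sqr ?nnegrE//.
  rewrite -lerN2 -(lerD2l (rho ^+ 2)) rE exprMn -ler_pdivlMl ?exprn_gt0//.
  apply: (@le_trans _ _ (e ^+ 2)); first by rewrite ler_sqr ?nnegrE ?harmonic_ge0 ?ltW.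
  by rewrite /e expr_div_n sqr_sqrtr 1?mulrC ?lexx ?ltW.
(* From rho on, the square root is 0 and so is its inverse: the tail contributes nothing. *)
have -> : (\int[mu]_(x in `[0%R, +oo[) (x / Num.sqrt (rho ^+ 2 - x ^+ 2))%:E =
    \int[mu]_(x in \bigcup_i F i) (x / Num.sqrt (rho ^+ 2 - x ^+ 2))%:E)%E.
  rewrite UF [LHS]integral_mkcond [RHS]integral_mkcond; apply: eq_integral => x _.
  rewrite !patchE !mem_setE !in_itv/= andbT; case: (leP 0 x) => x0 //=.
  case: (ltP x rho) => //= xrho; rewrite ler0_sqrtr ?invr0 ?mulr0//.
  by rewrite subr_le0 ler_sqr ?nnegrE// ltW.
pose f (x : R) := (x / Num.sqrt (rho ^+ 2 - x ^+ 2))%:E.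
have cv : (\int[mu]_(x in F i) f x @[i --> \oo] -->
    \int[mu]_(x in \bigcup_i F i) f x)%E.
  apply: ge0_nondecreasing_set_cvg_integral.
  - apply/nondecreasing_seqP => i; apply/subsetPset => x; rewrite /F /= !in_itv/=.
    by move=> /andP[-> xr]; rewrite (le_trans xr)// ndr.
  - by move=> i; exact: measurable_itv.
  - by move=> i; apply/measurable_EFinP/measurable_funTS; exact: measurable_cap.
  - move=> i x; rewrite /F /= in_itv/= => /andP[x0 _].
    by rewrite lee_fin divr_ge0// sqrtr_ge0.
rewrite -(cvg_lim _ cv)//; apply/cvg_lim => //.
have fE i : (\int[mu]_(x in F i) f x = (rho - rho * @harmonic R i)%:E)%E.
  (* The fundamental theorem of calculus wants a nondegenerate interval, whereas r 0 = 0. *)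
  have := r0 i; rewrite le_eqVlt => /predU1P[ri|ri].
    rewrite /F -ri set_itv1 integral_set1; congr EFin.
    move: (rE i); rewrite -ri expr0n/= subr0 => /eqP.
    rewrite eqf_sqr => /orP[/eqP<-|/eqP re]; first by rewrite subrr.
    have := mulr_gt0 rho0 (@harmonic_gt0 R i).
    by rewrite -oppr_lt0 -re => /(lt_trans rho0); rewrite ltxx.
  have dcap x : 0 <= x <= r i ->
      is_derive x 1 (fun y : R => - Num.sqrt (rho ^+ 2 - y ^+ 2))
        (x / Num.sqrt (rho ^+ 2 - x ^+ 2)).
    by move=> /ltr; exact: is_derive_sqrt_cap.
  have ccap x : 0 <= x <= r i ->
      {for x, continuous (fun y : R => - Num.sqrt (rho ^+ 2 - y ^+ 2))}.
    move=> /dcap d; apply: differentiable_continuous; apply/derivable1_diffP.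
    exact: ex_derive.
  rewrite (@continuous_FTC2 _ _ (fun y : R => - Num.sqrt (rho ^+ 2 - y ^+ 2)) _ _ ri).
  - rewrite rE sqrtr_sqr ger0_norm ?mulr_ge0 ?harmonic_ge0 ?ltW//.
    rewrite expr0n/= subr0 sqrtr_sqr ger0_norm ?ltW// -EFinB; congr EFin.
    by rewrite opprK addrC.
  - apply/continuous_in_subspaceT => x; rewrite inE/= in_itv/= => /ltr hx.
    apply: (@cvgM _ _ _ _ (fun y : R => y)); first exact: cvg_id.
    apply: cvgV; first by rewrite gt_eqF// sqrtr_gt0.
    apply: (@continuous_comp _ _ _ (fun y : R => rho ^+ 2 - y ^+ 2) Num.sqrt).
      by apply: cvgB; [exact: cvg_cst|exact: exprn_continuous].
    exact: sqrt_continuous.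
  - split.
    + move=> x; rewrite in_itv/= => /andP[x0 xr].
      by apply: (@ex_derive _ _ _ _ _ _ _ (dcap x _)); rewrite !ltW.
    + by apply: cvg_at_right_filter; apply: ccap; rewrite lexx r0.
    + by apply: cvg_at_left_filter; apply: ccap; rewrite lexx r0.
  - move=> x; rewrite in_itv/= => /andP[x0 xr]; rewrite derive1E.
    by apply: derive_val; apply: dcap; rewrite !ltW.
rewrite (_ : (fun i => _) = EFin \o (fun i => rho - rho * @harmonic R i)); last first.
  by apply/funext => i /=; rewrite fE.
apply: cvg_EFin; first exact: nearW.
rewrite -[X in _ --> X](subr0 rho) -[X in _ - X](mulr0 rho).
apply: cvgB; first exact: cvg_cst.
by apply: cvgM; [exact: cvg_cst|exact: cvg_harmonic].
Qed.

Lemma integral_cap (rho : R) : 0 < rho ->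
  (\int[mu]_x (`|x| / Num.sqrt (rho ^+ 2 - x ^+ 2))%:E = (2 * rho)%:E)%E.
Proof.
move=> rho0; pose f (x : R) := (`|x| / Num.sqrt (rho ^+ 2 - x ^+ 2))%:E.
have mf : measurable_fun [set: R] f.
  apply/measurable_EFinP; apply: measurable_funM.
    exact: normr_measurable.
  apply: (measurableT_comp measurable_invr); apply: (measurableT_comp measurable_sqrtr).
  by apply: measurable_funB.
have f0 x : (0 <= f x)%E by rewrite lee_fin divr_ge0// sqrtr_ge0.
have pos : (\int[mu]_(x in `[0%R, +oo[) f x = rho%:E)%E.
  rewrite -[RHS](integral_cap0y rho0); apply: eq_integral => x.
  by rewrite inE/= in_itv/= andbT => x0; rewrite /f ger0_norm.
rewrite -[X in (\int[mu]_(x in X) _)%E](setUv `]-oo, 0]%classic) ge0_integral_setU//.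
- rewrite setCitvl integral_itv_obnd_cbnd; last exact: measurable_funTS.
  rewrite pos.
  have -> : (\int[mu]_(x in `]-oo, 0%R])
      (`|x| / Num.sqrt (rho ^+ 2 - x ^+ 2))%:E = rho%:E)%E.
    rewrite -pos (ge0_integration_by_substitution0 mf f0).
    by apply: eq_integral => x _; rewrite /f normrN sqrrN.
  by rewrite -EFinD; congr EFin; ring.
- exact: measurableC.
- by rewrite setUv; exact: mf.
- by apply/disj_set2P; rewrite setICr.
Qed.

End cap_integral.

(** * Volumes of balls in R^2n and the integral of the Pansu density *)

Section pansu_integral.
Context {R : realType}.
Local Notation mu := (@lebesgue_measure R).
Local Notation RT := (measurableTypeR R).
Local Notation V n := ('rV[R]_n * 'rV[R]_n)%type.
Local Notation TT n := (n.-tuple RT * n.-tuple RT)%type.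
Local Notation pm n := (lebesgue_tuple R n \x lebesgue_tuple R n)%E.

Definition pair_ball n (s : R) : set (TT n) := [set t | radius (row_pair t) ^+ 2 <= s].
Arguments pair_ball : clear implicits.

Lemma measurable_pair_ball n s : measurable (pair_ball n s).
Proof.
apply: measurable_set_ler => //.
by apply: measurable_funX; exact: pair_measurable_radius.
Qed.

Lemma measure_pair_ball_indic n s :
  (pm n (pair_ball n s) = \int[pm n]_t (\1_(pair_ball n s) t)%:E)%E.
Proof. by rewrite integral_indic ?setIT//; exact: measurable_pair_ball. Qed.

Lemma measure_pair_ball_scale n s : 0 < s ->
  (pm n (pair_ball n s) = (s ^+ n)%:E * pm n (pair_ball n 1))%E.
Proof.
move=> s0; have sp : 0 < Num.sqrt s by rewrite sqrtr_gt0.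
pose z : n.-tuple RT := [tuple 0 | i < n].
have mz : measurable_fun [set: n.-tuple RT] (fun=> z) by exact: measurable_cst.
have mI : measurable_fun setT (fun t : TT n => (\1_(pair_ball n s) t : R)%:E).
  by apply/measurable_EFinP; apply: measurable_indic; exact: measurable_pair_ball.
rewrite !measure_pair_ball_indic (ge0_integral_pair_affine1 sp mz mI)//.
have mI1 : measurable_fun setT (fun p : TT n =>
    (\1_(pair_ball n s) (tuple_affine (Num.sqrt s) z p.1, p.2) : R)%:E).
  apply: (measurableT_comp mI); apply: measurable_fun_pair => //.
  exact: measurable_tuple_affine.
rewrite (ge0_integral_pair_affine2 sp mz mI1)// muleA -EFinM -exprMn.
rewrite -expr2 sqr_sqrtr ?ltW//; congr (_ * _)%E.
apply: eq_integral => -[t u] _ /=; rewrite !indicE; congr (_%:R)%:E.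
congr nat_of_bool.
have E : radius (row_pair
    (tuple_affine (Num.sqrt s) z t, tuple_affine (Num.sqrt s) z u)) ^+ 2 =
    s * radius (row_pair (t, u)) ^+ 2.
  rewrite !sqr_radius.
  rewrite (_ : row_pair _ = Num.sqrt s *: row_pair (t, u)).
    by rewrite dotZl dotZr mulrA -expr2 sqr_sqrtr// ltW.
  by congr pair; apply/rowP => j; rewrite !mxE !tnth_mktuple addr0.
have P (r : R) : (s * r <= s) = (r <= 1) by rewrite -ler_pdivlMl// mulVf ?gt_eqF.
by apply/idP/idP; rewrite !inE /pair_ball /= E P.
Qed.

Lemma measure_pair_ballE n :
  0 < Gamma (n%:R + 1 : R) /\
  pm n (pair_ball n 1) = (Num.sqrt pi ^+ (2 * n) / Gamma (n%:R + 1))%:E.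
Proof.
apply: (@sublevel_measure_Gamma _ _ _ (pair_lebesgue R n)
  (fun t => radius (row_pair t) ^+ 2)).
- by apply: measurable_funX; exact: pair_measurable_radius.
- by move=> t; exact: sqr_ge0.
- by move=> s s0; rewrite powR_mulrn ?ltW//; exact: measure_pair_ball_scale.
- exact: measure_ge0.
- by rewrite exprn_gt0// sqrtr_gt0 pi_gt0.
- exact: pair_integral_gauss.
Qed.

(** Puts the first coordinate innermost, so that [pansu_fiber] applies to the lines parallel to the
    first axis. *)
Lemma ge0_integral_tuple_cons_swap (m : nat) (f : m.+1.-tuple RT -> \bar R) :
  measurable_fun setT f -> (forall t, 0 <= f t)%E ->
  (\int[lebesgue_tuple R m.+1]_t f t =
  \int[lebesgue_tuple R m]_t \int[mu]_x f (cons_pair (x, t)))%E.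
Proof.
move=> mf f0; have mc := @measurable_cons_pair R m.
transitivity (\int[mu \x lebesgue_tuple R m]_p f (cons_pair p))%E.
  by rewrite (ge0_integral_pushforward mc)//= preimage_setT.
by rewrite fubini_tonelli2//; exact: measurableT_comp.
Qed.

Lemma pansu_fiber (lam b : R) : 0 < lam ->
  (\int[mu]_x ((Num.sqrt (1 - lam ^+ 2 * (x ^+ 2 + b)))^-1 * `|x|)%:E =
  (lam^-1)%:E * \int[mu]_x (\1_[set y : R | y ^+ 2 + b <= lam ^- 2] x)%:E)%E.
Proof.
move=> l0; pose c := lam ^- 2 - b.
have cE x : 1 - lam ^+ 2 * (x ^+ 2 + b) = lam ^+ 2 * (c - x ^+ 2).
  by rewrite /c; field; rewrite gt_eqF.
rewrite integral_indic//; last first.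
  by apply: measurable_set_ler => //; apply: measurable_funD.
rewrite setIT; have [c0|c0] := leP c 0.
  rewrite integral0_eq; last first.
    move=> x _; rewrite cE ler0_sqrtr ?invr0 ?mul0r//.
    by rewrite pmulr_rle0 ?exprn_gt0// subr_le0 (le_trans c0)// sqr_ge0.
  rewrite [X in (_ * X)%E](_ : _ = 0%E) ?mule0//.
  apply: (@subset_measure0 _ _ _ mu _ [set 0]) => //.
  - by apply: measurable_set_ler => //; apply: measurable_funD.
  - move=> x /= h; apply/eqP; rewrite -sqrf_eq0 eq_le sqr_ge0 andbT.
    by rewrite (le_trans _ c0)// /c lerBrDr.
  - exact: lebesgue_measure_set1.
pose rho := Num.sqrt c.
have rho0 : 0 < rho by rewrite sqrtr_gt0.
have rr : rho ^+ 2 = c by rewrite sqr_sqrtr// ltW.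
have -> : [set y : R | y ^+ 2 + b <= lam ^- 2] = `[- rho, rho]%classic.
  apply/seteqP; split => x /=; rewrite in_itv/= -ler_norml.
    by rewrite -lerBrDr -/c -rr -real_normK ?num_real// ler_sqr ?nnegrE// ltW.
  by rewrite -lerBrDr -/c -rr -real_normK ?num_real// ler_sqr ?nnegrE// ltW.
transitivity ((lam^-1)%:E * (2 * rho)%:E)%E; last first.
  congr (_ * _)%E; rewrite [RHS](lebesgue_measure_itv `[- rho, rho])/= lte_fin.
  by rewrite gtrN// opprK -EFinD; congr EFin; ring.
rewrite -(integral_cap rho0) -ge0_integralZl_EFin ?invr_ge0 1?ltW//; last first.
  apply/measurable_EFinP; apply: measurable_funM; first exact: normr_measurable.
  apply: (measurableT_comp measurable_invr); apply: (measurableT_comp measurable_sqrtr).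
  exact: measurable_funB.
apply: eq_integral => x _; rewrite -EFinM cE rr sqrtrM ?exprn_ge0 1?ltW//.
by rewrite sqrtr_sqr gtr0_norm// invfM -mulrA [_^-1 * `|x|]mulrC.
Qed.

Lemma measurable_pansu_density (lam : R) : measurable_fun [set: R]
  (fun r => (Num.sqrt (1 - lam ^+ 2 * r ^+ 2))^-1).
Proof.
apply: (measurableT_comp measurable_invr).
apply: (measurableT_comp measurable_sqrtr).
by apply: measurable_funB => //; apply: measurable_funM => //; exact: measurable_funX.
Qed.

(* The density vanishes for r >= 1 / lam, where sqrt of a nonpositive number
   and 0^-1 are both 0. *)
Lemma radial_integral_pansu (n : nat) (lam : R) : 0 < lam ->
  radial_integral (fun r => (Num.sqrt (1 - lam ^+ 2 * r ^+ 2))^-1)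
    ((delta_mx ord0 ord0, 0) : V n.+1) =
  ((lam ^+ (2 * n.+1).+1)^-1%:E * pm n.+1 (pair_ball n.+1 1))%E.
Proof.
move=> l0; pose g r := (Num.sqrt (1 - lam ^+ 2 * r ^+ 2))^-1.
have mg : measurable_fun setT g by exact: measurable_pansu_density.
pose A := pair_ball n.+1 (lam ^- 2).
(* The fibers assemble into lam^-1 times the volume of the ball of radius lam^-1; rescaling that
   ball to the unit one gives the remaining power of [lam]. *)
transitivity ((lam^-1)%:E * pm n.+1 A)%E; last first.
  have lE : lam^-1 * (lam ^- 2) ^+ n.+1 = (lam ^+ (2 * n.+1).+1)^-1.
    by rewrite exprVn -exprM exprS invfM.
  have l2 : 0 < lam ^- 2 by rewrite invr_gt0 exprn_gt0.
  by rewrite /A (measure_pair_ball_scale n.+1 l2) muleA -EFinM lE.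
rewrite measure_pair_ball_indic /radial_integral /pair_integral.
have mI : measurable_fun setT (fun t : TT n.+1 => (\1_A t : R)%:E).
  by apply/measurable_EFinP; apply: measurable_indic; exact: measurable_pair_ball.
pose f (t : TT n.+1) : \bar R :=
  (g (radius (row_pair t)) * `|dot (delta_mx ord0 ord0, 0) (row_pair t)|)%:E.
have mf : measurable_fun setT f.
  by apply/measurable_EFinP; exact: radial_integrand_measurable.
have f0 t : (0 <= f t)%E by rewrite lee_fin mulr_ge0// invr_ge0 sqrtr_ge0.
rewrite (fubini_tonelli2 f mf f0) (fubini_tonelli2 _ mI)//.
rewrite -ge0_integralZl_EFin ?invr_ge0 1?ltW//; last 2 first.
- by move=> u _; exact: integral_ge0.
- exact: measurable_fun_fubini_tonelli_G.
apply: eq_integral => u _; rewrite /fubini_G.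
have mpair : measurable_fun [set: n.+1.-tuple RT] (fun t : n.+1.-tuple RT => (t, u)).
  exact: measurable_fun_pair.
rewrite ge0_integral_tuple_cons_swap//; last exact: (measurableT_comp mf).
rewrite ge0_integral_tuple_cons_swap//; last exact: (measurableT_comp mI).
rewrite -ge0_integralZl_EFin ?invr_ge0 1?ltW//; last 2 first.
- by move=> t _; exact: integral_ge0.
- have mc : measurable_fun setT (fun p : RT * n.-tuple RT => (cons_pair p, u)).
    by apply: measurable_fun_pair => //; exact: measurable_cons_pair.
  apply: (measurable_fun_fubini_tonelli_G (m1 := mu) _ (measurableT_comp mI mc)) => p.
  by rewrite /= lee_fin.
apply: eq_integral => t _.
pose b := \sum_(i < n) tnth t i ^+ 2 + \sum_(i < n.+1) tnth u i ^+ 2.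
have rE x : radius (row_pair (cons_pair (x, t), u)) ^+ 2 = x ^+ 2 + b.
  rewrite sqr_radius /dot /rdot big_ord_recl /b /= addrA.
  rewrite mxE tnth0 -expr2; congr (_ + _ + _).
    by apply: eq_bigr => i _; rewrite mxE tnthS -expr2.
  by apply: eq_bigr => i _; rewrite mxE -expr2.
transitivity (\int[mu]_x ((Num.sqrt (1 - lam ^+ 2 * (x ^+ 2 + b)))^-1 * `|x|)%:E)%E.
  apply: eq_integral => x _; rewrite /f /g rE; congr (_ * `|_|)%:E.
  rewrite /dot /rdot big_ord_recl /= [X in X + _ + _](_ : _ = x).
    rewrite big1 ?addr0; last by move=> i _; rewrite !mxE mul0r.
    by rewrite big1 ?addr0// => i _; rewrite !mxE mul0r.
  by rewrite !mxE /= mul1r tnth0.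
rewrite pansu_fiber//; congr (_ * _)%E; apply: eq_integral => x _.
rewrite !indicE; congr (_%:R)%:E; congr nat_of_bool.
by apply/idP/idP; rewrite !inE /A /pair_ball /= rE.
Qed.

End pansu_integral.
Arguments pair_ball {R} n s.

(** * Tangent spaces and p-normals *)

Section derivatives.
Context {R : realType}.

Lemma is_derive_line (W : normedModType R) (w u : W) (t : R) :
  is_derive t 1 (fun s => w + s *: u) u.
Proof.
have [df fd] := is_diff_scalel t u.
have dg : is_derive t 1 (fun s : R => s *: u) u.
  apply: DeriveDef; first exact/derivable1_diffP.
  by rewrite deriveE// fd scale1r.
by rewrite -[X in is_derive _ _ _ X]add0r; exact: is_deriveD.
Qed.

Lemma is_derive_pair (U W : normedModType R) (f : R -> U) (g : R -> W) (t : R)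
    (a : U) (b : W) : is_derive t 1 f a -> is_derive t 1 g b ->
  is_derive t 1 (fun s => (f s, g s)) (a, b).
Proof.
move=> [/derivable1_diffP df fa] [/derivable1_diffP dg gb].
have dfg : differentiable (fun s => (f s, g s)) t by exact: differentiable_pair.
apply: DeriveDef; first exact/derivable1_diffP.
by rewrite deriveE// diff_pair//= -!deriveE// fa gb.
Qed.

Lemma is_derive_fst (U W : normedModType R) (f : R -> U * W) (t : R) (a : U * W) :
  is_derive t 1 f a -> is_derive t 1 (fun s => (f s).1) a.1.
Proof.
move=> [/derivable1_diffP df fa].
have d1 : differentiable (@fst U W) (f t).
  by apply: linear_differentiable => x; exact: cvg_fst.
have dc : differentiable (fst \o f) t by exact: differentiable_comp.
apply: (@DeriveDef _ _ _ _ _ (fst \o f)); first exact/derivable1_diffP.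
rewrite deriveE// diff_comp//= diff_lin/=; last by move=> x; exact: cvg_fst.
by rewrite -deriveE// fa.
Qed.

Lemma is_derive_snd (U W : normedModType R) (f : R -> U * W) (t : R) (a : U * W) :
  is_derive t 1 f a -> is_derive t 1 (fun s => (f s).2) a.2.
Proof.
move=> [/derivable1_diffP df fa].
have d1 : differentiable (@snd U W) (f t).
  by apply: linear_differentiable => x; exact: cvg_snd.
have dc : differentiable (snd \o f) t by exact: differentiable_comp.
apply: (@DeriveDef _ _ _ _ _ (snd \o f)); first exact/derivable1_diffP.
rewrite deriveE// diff_comp//= diff_lin/=; last by move=> x; exact: cvg_snd.
by rewrite -deriveE// fa.
Qed.

Lemma is_derive_coord n (f : R -> 'rV[R]_n) (t : R) (a : 'rV[R]_n) j :
  is_derive t 1 f a -> is_derive t 1 (fun s => f s ord0 j) (a ord0 j).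
Proof.
move=> [df fa]; apply: DeriveDef; first by have /derivable_mxP := df; exact.
by rewrite -fa derive_mx// mxE.
Qed.

Lemma is_derive_rdot n (f : R -> 'rV[R]_n) (t : R) (a : 'rV[R]_n) :
  is_derive t 1 f a -> is_derive t 1 (fun s => rdot (f s) (f s)) (2 * rdot (f t) a).
Proof.
move=> df; have dj j := is_derive_coord j df.
rewrite (_ : (fun s => _) =
  \sum_(j < n) (fun s => f s ord0 j * f s ord0 j)); last first.
  by apply/funext => s; rewrite fct_sumE.
apply: is_derive_eq; rewrite /rdot mulr_sumr; apply: eq_bigr => j _.
by rewrite /GRing.scale/=; ring.
Qed.

Lemma is_derive_radius n (f : R -> 'rV[R]_n * 'rV[R]_n) (t : R)
    (a : 'rV[R]_n * 'rV[R]_n) : is_derive t 1 f a -> 0 < radius (f t) ->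
  is_derive t 1 (fun s => radius (f s)) (dot (f t) a / radius (f t)).
Proof.
move=> df; rewrite radiusE sqrtr_gt0 => ft0.
have d1 := is_derive_rdot (is_derive_fst df).
have d2 := is_derive_rdot (is_derive_snd df).
have d3 : is_derive t 1 (fun s => dot (f s) (f s)) (2 * dot (f t) a).
  by rewrite /dot mulrDr; exact: is_deriveD.
rewrite (_ : (fun s => _) = Num.sqrt \o (fun s => dot (f s) (f s))); last first.
  by apply/funext => s; rewrite /= radiusE.
pose g s := dot (f s) (f s).
have d4 := @is_derive1_comp _ Num.sqrt g t _ _ (is_derive1_sqrt ft0) d3.
apply: (is_derive_eq d4).
have s0 : Num.sqrt (dot (f t) (f t)) != 0 by rewrite gt_eqF// sqrtr_gt0.
by field.
Qed.

(** [z] may switch between the branches arbitrarily often near 0, but each of its difference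
    quotients is a quotient of [f1] or of [f2], and both tend to [d]. *)
Lemma derive_two_branches (z f1 f2 : R -> R) (a d : R) :
  is_derive (0 : R) 1 z a -> is_derive (0 : R) 1 f1 d ->
  is_derive (0 : R) 1 f2 d -> z 0 = f1 0 -> z 0 = f2 0 ->
  (\forall t \near 0, z t = f1 t \/ z t = f2 t) -> a = d.
Proof.
move=> [dz za] [d1 f1d] [d2 f2d] z1 z2 zt; apply/eqP/negPn/negP => ad.
pose e := `|a - d| / 2.
have e0 : 0 < e by rewrite divr_gt0// normr_gt0 subr_eq0.
have cv (f : R -> R) (b : R) : derivable f 0 1 -> 'D_1 f 0 = b ->
    \forall h \near 0^', `|b - h^-1 * (f h - f 0)| < e.
  move=> df <-; have /cvgrPdist_lt /(_ _ e0) := df.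
  apply: filterS => h; rewrite /derive.
  by rewrite /GRing.scale/= mulr1 addr0.
have zt' : \forall t \near 0^', z t = f1 t \/ z t = f2 t.
  exact: nbhs_dnbhs.
(* A single [h] for which the three quotients are within |a - d| / 2 of their limits already
   contradicts the triangle inequality. *)
have [h [hz [h1 [h2 ht]]]] : exists h, `|a - h^-1 * (z h - z 0)| < e /\
    (`|d - h^-1 * (f1 h - f1 0)| < e /\ (`|d - h^-1 * (f2 h - f2 0)| < e /\
    (z h = f1 h \/ z h = f2 h))).
  apply: (@filter_ex _ (0 : R)^').
  by do 3 (apply: filterI; first exact: cv).
have : `|a - d| < e + e.
  case: ht => ht; rewrite ht ?z1 in hz.
    rewrite (_ : a - d = (a - h^-1 * (f1 h - f1 0)) -
      (d - h^-1 * (f1 h - f1 0))); last by ring.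
    by rewrite (le_lt_trans (ler_normB _ _))// ltrD.
  move: hz; rewrite -z1 z2 => hz.
  rewrite (_ : a - d = (a - h^-1 * (f2 h - f2 0)) -
      (d - h^-1 * (f2 h - f2 0))); last by ring.
  by rewrite (le_lt_trans (ler_normB _ _))// ltrD.
by rewrite /e -splitr ltxx.
Qed.

End derivatives.

Lemma diff_pair_fst {R : realType} (U V' W' : normedModType R) (f : U -> V')
    (g : U -> W') x v : differentiable f x -> differentiable g x ->
  ('d (fun y => (f y, g y)) x v).1 = 'd f x v.
Proof. by move=> df dg; rewrite diff_pair. Qed.

Lemma diff_affine {R : realType} (U W : normedModType R) (c : W)
    (f : {linear U -> W}) x v : continuous f ->
  differentiable (fun u => c + f u) x /\ 'd (fun u => c + f u) x v = f v.
Proof.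
move=> cf; have df : differentiable f x by exact: linear_differentiable.
have dc : differentiable (cst c : U -> W) x by exact: differentiable_cst.
split; first exact: (differentiableD dc df).
rewrite [LHS](congr1 (fun h : U -> W => h v) (diffD dc df)) /=.
by rewrite diff_cst diff_lin//= add0r.
Qed.

(** * Left translation, tangent spaces and p-normals of a rotation surface *)

Section geometry.
Context {R : realType} {n : nat}.
Local Notation V := ('rV[R]_n * 'rV[R]_n)%type.
Implicit Types (p q u v : heis R n) (w : V).

(** The horizontal part of the differential of a translation is read off from the differential of a
    pair, which requires the vertical component to be differentiable as well. *)
Lemma differentiable_vertical (a : heis R n) p : differentiable
  (fun u : heis R n => a.2 + u.2 + \sum_(j < n) (yc a j * xc u j - xc a j * yc u j)) p.
Proof.
have d2 : differentiable (fun u : heis R n => u.2) p.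
  by apply: linear_differentiable => x; exact: cvg_snd.
have d1 : differentiable (fun u : heis R n => u.1) p.
  by apply: linear_differentiable => x; exact: cvg_fst.
have d11 : differentiable (fun u : heis R n => u.1.1) p.
  apply: (@differentiable_comp _ _ _ _ (fun u : heis R n => u.1) fst) => //.
  by apply: linear_differentiable => x; exact: cvg_fst.
have d12 : differentiable (fun u : heis R n => u.1.2) p.
  apply: (@differentiable_comp _ _ _ _ (fun u : heis R n => u.1) snd) => //.
  by apply: linear_differentiable => x; exact: cvg_snd.
have dx j : differentiable (fun u : heis R n => xc u j) p.
  apply: (@differentiable_comp _ _ _ _ (fun u : heis R n => u.1.1)
    (fun M : 'rV[R]_n => M ord0 j)) => //.
  exact: differentiable_coord.
have dy j : differentiable (fun u : heis R n => yc u j) p.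
  apply: (@differentiable_comp _ _ _ _ (fun u : heis R n => u.1.2)
    (fun M : 'rV[R]_n => M ord0 j)) => //.
  exact: differentiable_coord.
apply: differentiableD; first by apply: differentiableD.
rewrite (_ : (fun u => _) =
  \sum_(j < n) (fun u : heis R n => yc a j * xc u j - xc a j * yc u j)); last first.
  by apply/funext => u; rewrite fct_sumE.
apply: differentiable_sum => j; apply: differentiableB.
  by apply: differentiableM.
by apply: differentiableM.
Qed.

Lemma push_left_horizontal q p v : (push_left q p v).1 = v.1.
Proof.
rewrite /push_left; set a := heis_mul q (heis_inv p).
have cfst : continuous (@fst V R) by move=> y; exact: cvg_fst.
have [dh hv] := diff_affine (f := @fst V R) a.1 p v cfst.
exact: (etrans (diff_pair_fst v dh (differentiable_vertical a p)) hv).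
Qed.

Lemma levi_push_left q p v (u : heis R n) :
  levi (push_left q p v) u = dot v.1 u.1.
Proof. by rewrite leviE push_left_horizontal. Qed.

Lemma contactE q u : contact q u <-> u.2 + dot (rotJ q.1) u.1 = 0.
Proof.
rewrite /contact /= (_ : \sum_(j < n) _ = dot (rotJ q.1) u.1)//.
rewrite /dot /rdot -big_split; apply: eq_bigr => j _ /=.
by rewrite !mxE /xc /yc; ring.
Qed.

Section tangent.
Variables (Rr : R) (h1 h2 : R -> R) (w : V) (d : R).
Hypotheses (wpos : 0 < radius w < Rr).
Hypotheses (dh1 : is_derive (radius w) 1 h1 d)
  (dh2 : h1 (radius w) = h2 (radius w) -> is_derive (radius w) 1 h2 d)
  (ch2 : {for radius w, continuous h2}).

Let q : heis R n := (w, h1 (radius w)).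

Let S := rot_surface n Rr h1 h2.

(** [dh2] treats the points where the sheets meet, [ch2] the others. The point [q] lies on the first
    sheet; exchanging [h1] and [h2] gives the other one. *)
Lemma tangent_rot_surface u :
  tangent S q u <-> u.2 = d * (dot w u.1 / radius w).
Proof.
have r0 : 0 < radius w by case/andP: wpos.
split=> [[g [g0 gS dg]]|uE].
  have dg1 := is_derive_fst dg; have dg2 := is_derive_snd dg.
  have g01 : (g 0).1 = w by rewrite g0.
  have dr : is_derive (0 : R) 1 (fun s => radius (g s).1) (dot w u.1 / radius w).
    by rewrite -{1 2}g01; apply: is_derive_radius; rewrite ?g01.
  have d1 : is_derive (0 : R) 1 (h1 \o (fun s => radius (g s).1))
      (d * (dot w u.1 / radius w)).
    by apply: is_derive1_comp; rewrite g01.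
  have cr : {for (0 : R), continuous (fun s => radius (g s).1)}.
    apply: differentiable_continuous; apply/derivable1_diffP; exact: ex_derive.
  have cz : {for (0 : R), continuous (fun s => (g s).2)}.
    apply: differentiable_continuous; apply/derivable1_diffP; exact: ex_derive.
  have [h12|h12] := eqVneq (h1 (radius w)) (h2 (radius w)).
    have d2 : is_derive (0 : R) 1 (h2 \o (fun s => radius (g s).1))
        (d * (dot w u.1 / radius w)).
      by apply: is_derive1_comp; rewrite g01; exact: dh2.
    apply: (derive_two_branches dg2 d1 d2); rewrite /= ?g0//.
    by apply: filterS gS => t [] [_ ->]; [left|right].
  (* Away from a meeting point the curve stays off the second sheet near 0, by continuity of [h2],
     so both branches are taken to be the first sheet. *)
  apply: (derive_two_branches dg2 d1 d1); rewrite /= ?g0//.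
  have ch : {for (0 : R), continuous (fun s => (g s).2 - h2 (radius (g s).1))}.
    apply: continuousB => //.
    apply: (@continuous_comp _ _ _ (fun s => radius (g s).1) h2) => //.
    by rewrite g01.
  have hne : (g 0).2 - h2 (radius (g 0).1) != 0 by rewrite g0 subr_eq0.
  have := ch; move=> /(_ [set x | x != 0]) /= nz.
  have {nz} : \forall t \near (0 : R), (g t).2 - h2 (radius (g t).1) != 0.
    by apply: nz; apply: open_nbhs_nbhs; split => //; exact: open_neq.
  move=> nz; near=> t.
  have : S (g t) by near: t.
  have : (g t).2 - h2 (radius (g t).1) != 0 by near: t.
  by move=> + [] [_ E]; [left|rewrite E subrr eqxx].
(* The witness is the lift to the first sheet of a straight line in R^2n. *)
exists (fun t : R => (w + t *: u.1, h1 (radius (w + t *: u.1)))).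
have dl : is_derive (0 : R) 1 (fun t : R => w + t *: u.1) u.1.
  exact: is_derive_line.
have dr : is_derive (0 : R) 1 (fun t : R => radius (w + t *: u.1))
    (dot w u.1 / radius w).
  have := is_derive_radius dl; rewrite scale0r addr0; exact.
split.
- by rewrite scale0r addr0.
- have cr : {for (0 : R), continuous (fun t : R => radius (w + t *: u.1))}.
    apply: differentiable_continuous; apply/derivable1_diffP; exact: ex_derive.
  have : \forall t \near (0 : R), radius (w + t *: u.1) < Rr.
    move: cr => /(_ [set x | x < Rr]) /=; apply.
    apply: open_nbhs_nbhs; split; first exact: open_lt.
    by rewrite /= scale0r addr0; case/andP: wpos.
  by apply: filterS => t tR; left; split => //=; exact: ltW.
- rewrite [u]surjective_pairing uE; apply: is_derive_pair => //.
  apply: (@is_derive1_comp _ h1 (fun t : R => radius (w + t *: u.1))).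
  by rewrite scale0r addr0.
Unshelve. all: by end_near. Qed.

(** For f = h(r) its coordinates are f_{x_j} - y_j and f_{y_j} + x_j: up to sign, D times the
    horizontal part of the p-normal, and D is its length. *)
Let N0 : V := (d / radius w) *: w + rotJ w.

Lemma dot_pnormal_direction : dot N0 N0 = ((d / radius w) ^+ 2 + 1) * radius w ^+ 2.
Proof.
rewrite sqr_radius /N0 !(dotDl, dotDr, dotZl, dotZr) dotJl dotJJ (dotwJ w); ring.
Qed.

Lemma pnormal_direction_gt0 : 0 < dot N0 N0.
Proof.
rewrite dot_pnormal_direction mulr_gt0// ?exprn_gt0//; last by case/andP: wpos.
by rewrite ltr_wpDl ?sqr_ge0.
Qed.

Lemma tangentE u : tangent S q u <-> u.2 = dot ((d / radius w) *: w) u.1.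
Proof. by rewrite tangent_rot_surface dotZl mulrA mulrAC. Qed.

(** Adding the equations of the tangent space and of the contact plane gives <N0, u> = 0, so the
    tangent vector above [N0] is not in the contact plane. *)
Lemma nonsingular_rot_surface : nonsingular S q.
Proof.
move=> tc; have := pnormal_direction_gt0.
have : tangent S q (N0, dot ((d / radius w) *: w) N0) by apply/tangentE.
by rewrite tc => /contactE /=; rewrite -dotDl -/N0 => ->; rewrite ltxx.
Qed.

(** The absolute values absorb the sign ambiguity of the p-normal, and the factor [radius N0] is the
    area density that multiplies it in the integral. *)
Lemma dot_pnormal v N : is_pnormal S q N ->
  `|dot v.1 N.1| * radius N0 = `|dot v.1 N0|.
Proof.
move=> [_ _ _ NN Nort]; have D0 := pnormal_direction_gt0.
have Dn : dot N0 N0 != 0 by rewrite gt_eqF.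
(* [u] is the part of [N] orthogonal to [N0]. It lifts to a vector that is both tangent and contact,
   so the p-normal is orthogonal to it as well, and u = 0. Normalization then gives |k| = 1 /
   |N0|. *)
pose k := dot N0 N.1 / dot N0 N0.
pose u : V := N.1 - k *: N0.
have N0u : dot N0 u = 0.
  by rewrite /u dotDr -scaleNr dotZr mulNr /k divfK// subrr.
have Nu : dot N.1 u = 0.
  rewrite -[LHS](leviE N (u, dot ((d / radius w) *: w) u)).
  apply: Nort; first exact/tangentE.
  by apply/contactE => /=; rewrite -dotDl.
have uu : dot u u = 0.
  by rewrite {1}/u dotDl -scaleNr dotZl N0u Nu mulr0 addr0.
have NE : N.1 = k *: N0.
  apply/eqP; rewrite -subr_eq0 -/u; move/eqP: uu.
  rewrite paddr_eq0 ?rdot_ge0// !rdot_eq0; case: (u) => x y /= /andP[/eqP-> /eqP->].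
  by [].
have kk : `|k| * radius N0 = 1.
  have k2 : (k * radius N0) ^+ 2 = 1.
    rewrite exprMn sqr_radius; move: NN; rewrite leviE NE dotZl dotZr => <-; ring.
  rewrite -[radius N0]ger0_norm ?radius_ge0// -normrM.
  by apply/eqP; rewrite -(@eqrXn2 _ 2) ?expr1n// real_normK ?num_real// k2.
by rewrite NE dotZr normrM mulrAC kk mul1r.
Qed.

End tangent.
End geometry.

(** * The integral over a sheet *)

Section sheet.
Context {R : realType}.
Local Notation RT := (measurableTypeR R).

Lemma derive_along_line (U W : normedModType R) (f : U -> W) (x v : U) :
  'D_v f x = 'D_1 (fun t : R => f (x + t *: v)) 0.
Proof.
rewrite /derive; pose g (t : R) := f (x + t *: v).
rewrite (_ : (fun k : R => k^-1 *: ((f \o shift x) (k *: v) - f x)) =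
  (fun k : R => k^-1 *: ((g \o shift 0) (k *: (1 : R)) - g 0)))//.
apply/funext => k; rewrite /g /= scale0r !addr0.
rewrite [X in f X]addrC; congr (_ *: (f (x + _ *: v) - _)).
by rewrite /GRing.scale/= mulr1.
Qed.

(** The derivative is a pointwise limit of difference quotients along 1 / (i + 1). They are taken
    for [h] extended by 0, which is measurable on the whole line and agrees with [h] near each point
    of the interval. *)
Lemma measurable_derive1_oo (h : R -> R) (b : R) :
  (forall r, 0 < r < b -> derivable h r 1) -> measurable_fun `]0, b[ (derive1 h).
Proof.
move=> dh; pose D : set R := `]0, b[%classic; pose g := h \_ D.
have mg : measurable_fun setT g.
  apply/(measurable_restrictT _ (measurable_itv _)).
  apply: open_continuous_measurable_fun; first exact: interval_open.
  move=> x; rewrite inE /D /= in_itv/= => xb.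
  by apply: differentiable_continuous; apply/derivable1_diffP; exact: dh.
apply: (@measurable_fun_cvg _ _ _ _
  (fun i x => (@harmonic R i)^-1 * (g (@harmonic R i + x) - g x))).
  move=> i; apply: measurable_funTS; apply: measurable_funM => //.
  by apply: measurable_funB => //; apply: (measurableT_comp mg); apply: measurable_funD.
move=> x Dx; have xb : 0 < x < b by move: Dx; rewrite /= in_itv.
have gh : \forall y \near x, h y = g y.
  have : \forall y \near x, D y.
    by apply: open_nbhs_nbhs; split => //; exact: interval_open.
  by apply: filterS => y Dy; rewrite /g patchE mem_set.
have dg : is_derive x 1 g ((derive1 h) x).
  rewrite derive1E; apply: (near_eq_is_derive gh).
  exact: DeriveDef (dh _ xb) _.
have [dg' <-] := dg.
have hn : @harmonic R @ \oo --> (0 : R)^'.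
  move=> A; rewrite /dnbhs /within/= => /(@cvg_harmonic R) [i _ hi].
  by exists i => // j ij; apply: hi => //; rewrite gt_eqF// harmonic_gt0.
have := cvg_comp _ _ hn dg'; apply: cvg_trans; apply: near_eq_cvg.
by apply: nearW => i /=; rewrite /GRing.scale/= mulr1.
Qed.

Section fixed_dimension.
Context {n : nat}.
Local Notation V := ('rV[R]_n * 'rV[R]_n)%type.
Local Notation TT := (n.-tuple RT * n.-tuple RT)%type.

Lemma area_density_radial (h : R -> R) (d : R) (w : V) : 0 < radius w ->
  is_derive (radius w) 1 h d ->
  area_density (h \o @Defs.radius R n) w = radius ((d / radius w) *: w + rotJ w).
Proof.
move=> r0 dh.
have DE v : 'D_v (h \o @Defs.radius R n) w = (d / radius w) * dot w v.
  rewrite derive_along_line.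
  have dr : is_derive (0 : R) 1 (fun t : R => radius (w + t *: v)) (dot w v / radius w).
    have := is_derive_radius (is_derive_line w v 0).
    by rewrite scale0r addr0; exact.
  have dc : is_derive (0 : R) 1 (h \o (fun t : R => radius (w + t *: v)))
      (d * (dot w v / radius w)).
    by apply: is_derive1_comp; rewrite scale0r addr0.
  by rewrite (@derive_val _ _ _ _ _ _ _ dc); ring.
have dx j : dot w (delta_mx 0 j, 0) = w.1 ord0 j.
  rewrite /dot /rdot (bigD1 j)//= mxE !eqxx mulr1 big1 ?addr0 => [|i ij].
    by rewrite big1 ?addr0// => i _; rewrite mxE mulr0.
  by rewrite mxE (negbTE ij) andbF mulr0.
have dy j : dot w (0, delta_mx 0 j) = w.2 ord0 j.
  rewrite /dot /rdot big1 ?add0r => [|i _]; last by rewrite mxE mulr0.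
  rewrite (bigD1 j)//= mxE !eqxx mulr1 big1 ?addr0// => i ij.
  by rewrite mxE (negbTE ij) andbF mulr0.
rewrite /area_density [RHS]/Defs.radius; congr Num.sqrt.
by apply: eq_bigr => j _; rewrite !DE dx dy !mxE.
Qed.

(** The coefficient a = h'(r) / r, cut off so that, together with the indicator as coefficient of J
    w, the integral over the ball becomes one over all of R^2n. *)
Definition slope_profile (b : R) (h : R -> R) : R -> R :=
  (fun r => (derive1 h) r / r) \_ `]0, b[.

Lemma measurable_slope_profile (b : R) (h : R -> R) :
  (forall r, 0 < r < b -> derivable h r 1) ->
  measurable_fun setT (slope_profile b h).
Proof.
move=> dh; apply/(measurable_restrictT _ (measurable_itv _)).
apply: measurable_funM; first exact: measurable_derive1_oo.
by apply: measurable_funTS; exact: measurable_invr.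
Qed.

Lemma radius_eq0 (w : V) : radius w = 0 -> w = 0.
Proof.
rewrite radiusE => /eqP; rewrite sqrtr_eq0 => h.
have : dot w w == 0 by rewrite eq_le h dot_ge0.
rewrite paddr_eq0 ?rdot_ge0// !rdot_eq0; case: w {h} => x y /=.
by move=> /andP[/eqP-> /eqP->].
Qed.

Lemma sheet_integral_rotor (b : R) (h : R -> R) (phi : heis R n -> R) (v : V) :
  (0 < n)%N -> (forall r, 0 < r < b -> derivable h r 1) ->
  (forall w : V, 0 < radius w < b ->
    phi (w, h (radius w)) * radius (((derive1 h) (radius w) / radius w) *: w + rotJ w) =
    `|dot v (((derive1 h) (radius w) / radius w) *: w + rotJ w)|) ->
  sheet_integral b h phi =
  rotor_integral (slope_profile b h) (\1_`]0, b[) v.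
Proof.
move=> n0 dh phiE.
pose D : set TT := [set t | radius (row_pair t) < b].
have mD : measurable D.
  by apply: measurable_set_ltr => //; exact: pair_measurable_radius.
pose N : set TT := [set t | radius (row_pair t) = 0].
have mN : measurable N.
  rewrite (_ : N = [set t | radius (row_pair t) <= 0]).
    by apply: measurable_set_ler => //; exact: pair_measurable_radius.
  apply/seteqP; split => t /=; first by move=> ->.
  by move=> le0; apply/eqP; rewrite eq_le le0 radius_ge0.
pose F w := `|rotor (slope_profile b h) (\1_`]0, b[) v w|.
have mF : pair_measurable n F.
  apply: pair_measurable_norm; apply: pair_measurable_rotor.
    exact: measurable_slope_profile.
  by apply: measurable_indic; exact: measurable_itv.
pose G w := phi (w, h (radius w)) * area_density (h \o @Defs.radius R n) w.
have GF w : 0 < radius w < b -> G w = F w.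
  move=> wb; have /andP[w0 _] := wb.
  have dhw : is_derive (radius w) 1 h ((derive1 h) (radius w)).
    by rewrite derive1E; exact: DeriveDef (dh _ wb) _.
  rewrite /G (area_density_radial w0 dhw) phiE// /F /rotor /slope_profile.
  rewrite patchE indicE mem_set/=; last by rewrite /= in_itv.
  by rewrite mul1r dotDr dotZr dotJl opprK.
have F0 w : ~~ (0 < radius w < b) -> F w = 0.
  move=> wb; rewrite /F /rotor /slope_profile patchE indicE memNset/=; last first.
    by rewrite in_itv/=; exact/negP.
  by rewrite !mul0r subr0 normr0.
have -> : sheet_integral b h phi =
    (\int[lebesgue_tuple R n \x lebesgue_tuple R n]_(t in D) (G (row_pair t))%:E)%E.
  by [].
have -> : rotor_integral (slope_profile b h) (\1_`]0, b[) v =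
    (\int[lebesgue_tuple R n \x lebesgue_tuple R n]_(t in D) (F (row_pair t))%:E)%E.
  rewrite [RHS]integral_mkcond; apply: eq_integral => t _.
  rewrite patchE; case: ifPn => //; rewrite notin_setE /D /= => tb.
  by rewrite -/(F _) F0// negb_and; apply/orP; right; exact/negP.
(* Nothing is known about [phi] on the axis, but the axis projects to the single point w = 0. There
   [G] is one constant, so on the ball it is [F] plus a multiple of the indicator of a null set,
   hence measurable. *)
have GE t : D t -> G (row_pair t) = F (row_pair t) + G 0 * \1_N t.
  move=> Dt; rewrite indicE; have [tN|tN] := boolP (t \in N).
    move: tN; rewrite inE => tN; rewrite (radius_eq0 tN) F0 ?add0r ?mulr1//.
    by rewrite -(radius_eq0 tN) tN ltxx.
  rewrite mulr0 addr0 GF//; apply/andP; split; last exact: Dt.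
  rewrite lt_neqAle radius_ge0 andbT eq_sym; apply/eqP => t0.
  by move: tN; rewrite notin_setE; apply.
apply: ae_eq_integral => //.
- apply/measurable_EFinP.
  apply: (eq_measurable_fun (fun t => F (row_pair t) + G 0 * \1_N t)).
    by move=> t /[!inE] Dt; rewrite GE.
  apply: measurable_funTS; apply: measurable_funD => //.
  by apply: measurable_funM => //; exact: measurable_indic.
- by apply/measurable_EFinP; apply: measurable_funTS.
exists N; split => //; first exact: pair_null_origin.
move=> t /=; apply: contra_notP => tN Dt; rewrite GE// indicE memNset//.
by rewrite mulr0 addr0.
Qed.

End fixed_dimension.
End sheet.

(** * Projected areas *)

Section projected_area.
Context {R : realType} {m : nat}.
Local Notation RT := (measurableTypeR R).
Local Notation n := m.+1.
Local Notation V := ('rV[R]_n * 'rV[R]_n)%type.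
Local Notation pm := (lebesgue_tuple R n \x lebesgue_tuple R n)%E.

Implicit Types (b r : R) (h : R -> R).

Definition area_profile (b : R) (h : R -> R) (r : R) : R :=
  Num.sqrt (slope_profile b h r ^+ 2 + \1_`]0, b[ r ^+ 2).

Definition profile_integral (b : R) (h : R -> R) : \bar R :=
  radial_integral (area_profile b h) ((delta_mx ord0 ord0, 0) : V).

Lemma measurable_area_profile b h :
  (forall r, 0 < r < b -> derivable h r 1) ->
  measurable_fun setT (area_profile b h).
Proof.
move=> dh; apply: (measurableT_comp measurable_sqrtr).
apply: measurable_funD; apply: measurable_funX.
  exact: measurable_slope_profile.
by apply: measurable_indic; exact: measurable_itv.
Qed.

Lemma area_profileE b h r : 0 < r < b ->
  area_profile b h r = Num.sqrt ((derive1 h r / r) ^+ 2 + 1).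
Proof.
move=> rb; rewrite /area_profile /slope_profile.
rewrite patchE indicE mem_set/=; last by rewrite in_itv.
by rewrite expr1n.
Qed.

Lemma area_profile_out b h r : ~~ (0 < r < b) -> area_profile b h r = 0.
Proof.
move=> rb; rewrite /area_profile /slope_profile patchE indicE memNset/=; last first.
  by rewrite in_itv/=; exact/negP.
by rewrite expr0n/= addr0 sqrtr0.
Qed.

Lemma rdot_delta0 : rdot (delta_mx ord0 ord0 : 'rV[R]_n) (delta_mx ord0 ord0) = 1.
Proof.
rewrite /rdot big_ord_recl big1 ?addr0; first by rewrite !mxE mulr1.
by move=> i _; rewrite !mxE mul0r.
Qed.

Lemma sheet_integral_pnormal (b : R) (h1 h2 : R -> R) (N : heis R n -> heis R n)
    (p v : heis R n) :
  (forall r, 0 < r < b -> derivable h1 r 1 /\ derivable h2 r 1) ->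
  (forall r, 0 < r < b -> h1 r = h2 r -> derive1 h1 r = derive1 h2 r) ->
  pnormal_field b h1 h2 N -> levi v v = 1 ->
  sheet_integral b h1 (fun q => `|levi (push_left q p v) (N q)|) =
  profile_integral b h1.
Proof.
move=> dh h12 pN vv.
have dh1 r : 0 < r < b -> derivable h1 r 1 by move=> /dh[].
rewrite (@sheet_integral_rotor _ _ _ _ _ v.1)//; last first.
  move=> w wb; have [d1 d2] := dh _ wb.
  have D1 : is_derive (radius w) 1 h1 (derive1 h1 (radius w)).
    by rewrite derive1E; exact: DeriveDef d1 _.
  have D2 : h1 (radius w) = h2 (radius w) ->
      is_derive (radius w) 1 h2 (derive1 h1 (radius w)).
    by move=> e; rewrite (h12 _ wb e) derive1E; exact: DeriveDef d2 _.
  have c2 : {for radius w, continuous h2}.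
    by apply: differentiable_continuous; exact/derivable1_diffP.
  rewrite levi_push_left; apply: (dot_pnormal wb D1 D2 c2).
  apply: (pN (w, h1 (radius w))) => //=; last first.
    exact: (nonsingular_rot_surface wb D1 D2 c2).
  by left; split => //=; case/andP: wb => _ /ltW.
rewrite rotor_integralE; last 2 first.
- exact: measurable_slope_profile.
- by apply: measurable_indic; exact: measurable_itv.
rewrite (radial_integralE v.1 (measurable_area_profile dh1)
  (fun r => sqrtr_ge0 _) rdot_delta0).
by rewrite radiusE -leviE vv sqrtr1 mul1e.
Qed.

Lemma projected_areaE (b : R) (h1 h2 : R -> R) (N : heis R n -> heis R n)
    (p v : heis R n) :
  (forall r, 0 < r < b -> derivable h1 r 1 /\ derivable h2 r 1) ->
  (forall r, 0 < r < b -> h1 r = h2 r -> derive1 h1 r = derive1 h2 r) ->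
  pnormal_field b h1 h2 N -> levi v v = 1 ->
  projected_area b h1 h2 N p v =
  (profile_integral b h1 + profile_integral b h2)%E.
Proof.
move=> dh h12 pN vv; rewrite /projected_area /rot_integral.
rewrite (sheet_integral_pnormal p dh h12 pN vv); congr (_ + _)%E.
apply: (@sheet_integral_pnormal b h2 h1) => //.
- by move=> r /dh[].
- by move=> r /h12 h /esym /h.
- by move: pN; rewrite /pnormal_field /rot_surface setUC.
Qed.

(** Near an interior point the restriction to [0, b] is void, so the one-sided convention at the
    endpoints does not matter here. *)
Lemma derive_within_interior (b : R) (h : R -> R) r d : 0 < r < b ->
  derivable h r 1 -> deriv_within `[0, b] h r d -> derive1 h r = d.
Proof.
move=> rb dh hd; rewrite derive1E; apply/cvg_lim => //.
have sh : (k + r) @[k --> (0 : R)^'] --> within (`[0, b] `\ r) (nbhs r).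
  move=> A; rewrite /within /= => Ar.
  have nr : \forall k \near (0 : R), k + r \in `]0, b[.
    have cs : {for (0 : R), continuous (fun k : R => k + r)}.
      by apply: continuousD; [exact: cvg_id|exact: cst_continuous].
    move: cs; rewrite /prop_for /continuous_at /= add0r => cs.
    have rI : r \in `]0, b[ by rewrite in_itv.
    exact: (cs [set x | x \in `]0, b[] (near_in_itvoo rI)).
  have nA : \forall k \near (0 : R), (`[0, b] `\ r) (k + r) -> A (k + r).
    have cs : {for (0 : R), continuous (fun k : R => k + r)}.
      by apply: continuousD; [exact: cvg_id|exact: cst_continuous].
    by move: cs; rewrite /prop_for /continuous_at /= add0r => /(_ _ Ar).
  rewrite /nbhs /= /dnbhs /within /=; near=> k => k0.
  have : (`[0, b] `\ r) (k + r) -> A (k + r) by near: k.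
  apply; split; last by move=> /= /eqP; rewrite -subr_eq0 addrK (negbTE k0).
  have : k + r \in `]0, b[ by near: k.
  by rewrite /= !in_itv/= => /andP[/ltW-> /ltW->].
have := cvg_comp _ _ sh hd; apply: cvg_trans; apply: near_eq_cvg.
apply: nearW => k /=; rewrite addrK /GRing.scale/= mulr1.
by rewrite mulrC.
Unshelve. all: by end_near. Qed.

Lemma norm_dot_delta_le (w : V) :
  `|dot (delta_mx ord0 ord0, 0) w| <= radius w.
Proof.
have -> : dot (delta_mx ord0 ord0, 0) w = w.1 ord0 ord0.
  rewrite /dot /rdot big_ord_recl !mxE mul1r big1 ?addr0.
    by rewrite big1 ?addr0// => i _; rewrite !mxE mul0r.
  by move=> i _; rewrite !mxE mul0r.
rewrite radiusE -sqrtr_sqr ler_wsqrtr// /dot /rdot big_ord_recl -expr2.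
rewrite -addrA lerDl addr_ge0//; last exact: rdot_ge0.
by apply: sumr_ge0 => i _; rewrite -expr2 sqr_ge0.
Qed.

(** [A] accounts for C^1 profiles and [B] for bounded ones. The term with [B] is the density of the
    Pansu sphere with lam = 1 / b, whose integral is known; the singularity A / r at the axis is
    absorbed by |<e, w>| <= r. *)
Lemma profile_integral_fin (b A B : R) (h : R -> R) : 0 < b ->
  (forall r, 0 < r < b -> derivable h r 1) -> 0 <= A -> 0 <= B ->
  (forall r, 0 < r < b -> `|derive1 h r| <=
     A + B * (r / Num.sqrt (1 - b^-1 ^+ 2 * r ^+ 2))) ->
  profile_integral b h \is a fin_num.
Proof.
move=> b0 dh A0 B0 hAB; pose k r := (Num.sqrt (1 - b^-1 ^+ 2 * r ^+ 2))^-1.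
have mk : measurable_fun setT k by exact: measurable_pansu_density.
have k0 r : 0 <= k r by rewrite invr_ge0 sqrtr_ge0.
pose e : V := (delta_mx ord0 ord0, 0).
have mA : pair_measurable n (fun w => area_profile b h (radius w) * `|dot e w|).
  by apply: radial_integrand_measurable; exact: measurable_area_profile.
have ball_fin : pm (pair_ball n (b ^+ 2)) \is a fin_num.
  rewrite measure_pair_ball_scale ?exprn_gt0//.
  by have [_ ->] := @measure_pair_ballE R n; rewrite -EFinM.
have bV : 0 < b^-1 by rewrite invr_gt0.
have rad_fin : radial_integral k e \is a fin_num.
  rewrite radial_integral_pansu//.
  by have [_ ->] := @measure_pair_ballE R n; rewrite -EFinM.
have mB : measurable_fun setT (fun t : n.-tuple RT * n.-tuple RT =>
    ((A + b) * \1_(pair_ball n (b ^+ 2)) t)%:E).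
  apply/measurable_EFinP; apply: measurable_funM => //.
  by apply: measurable_indic; exact: measurable_pair_ball.
have mR : pair_measurable n (fun w => k (radius w) * `|dot e w|).
  exact: radial_integrand_measurable.
have P0 : (0 <= profile_integral b h)%E.
  by apply: integral_ge0 => t _; rewrite lee_fin mulr_ge0// sqrtr_ge0.
(* With sqrt (a^2 + 1) <= |a| + 1, the summand [A] bounds (A / r) |<e, w>| and [b] bounds the
   product of 1 and |<e, w>|. *)
pose f1 t : \bar R := ((A + b) * \1_(pair_ball n (b ^+ 2)) t)%:E.
pose f2 t : \bar R := (B * (k (radius (row_pair t)) * `|dot e (row_pair t)|))%:E.
have Ab0 : 0 <= A + b by rewrite addr_ge0// ltW.
have f10 t : (0 <= f1 t)%E by rewrite lee_fin mulr_ge0.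
have f20 t : (0 <= f2 t)%E by rewrite lee_fin !mulr_ge0.
have mf2 : measurable_fun setT f2.
  by apply/measurable_EFinP; apply: measurable_funM.
have I1 : (\int[pm]_t f1 t)%E \is a fin_num.
  rewrite (_ : (\int[pm]_t f1 t)%E = ((A + b)%:E * pm (pair_ball n (b ^+ 2)))%E).
    by rewrite fin_numM.
  rewrite measure_pair_ball_indic -ge0_integralZl_EFin//.
  by apply/measurable_EFinP; apply: measurable_indic; exact: measurable_pair_ball.
have I2 : (\int[pm]_t f2 t)%E \is a fin_num.
  have -> : (\int[pm]_t f2 t = B%:E * radial_integral k e)%E.
    by rewrite -ge0_pair_integralZl// => w; rewrite mulr_ge0.
  by rewrite fin_numM.
rewrite ge0_fin_numE//; apply: (@le_lt_trans _ _ (\int[pm]_t (f1 t + f2 t))%E).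
  apply: ge0_le_integral => //.
  - by move=> t _; rewrite lee_fin mulr_ge0// sqrtr_ge0.
  - exact/measurable_EFinP.
  - exact: emeasurable_funD.
  move=> t _; rewrite -EFinD lee_fin; set w := row_pair t; set r := radius w.
  have er : `|dot e w| <= r by exact: norm_dot_delta_le.
  have [rb|rb] := boolP (0 < r < b); last first.
    rewrite area_profile_out// mul0r.
    by rewrite addr_ge0// !mulr_ge0.
  have /andP[r0 /ltW rb'] := rb.
  rewrite area_profileE// indicE mem_set ?mulr1; last first.
    by rewrite /pair_ball /= -/w -/r ler_sqr// nnegrE ltW.
  pose a := derive1 h r / r.
  have sa : Num.sqrt (a ^+ 2 + 1) <= `|a| + 1.
    rewrite -[leRHS]ger0_norm ?addr_ge0// -sqrtr_sqr ler_wsqrtr//.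
    by rewrite sqrrD1 real_normK ?num_real// lerD2r lerDl mulrn_wge0.
  apply: (le_trans (ler_wpM2r (normr_ge0 _) sa)).
  have ha : `|a| <= A / r + B * k r.
    rewrite normrM normfV (gtr0_norm r0) ler_pdivrMr// mulrDl divfK ?gt_eqF//.
    by rewrite -mulrA [k r * r]mulrC; exact: hAB.
  apply: (@le_trans _ _ ((A / r + B * k r + 1) * `|dot e w|)).
    by rewrite ler_wpM2r// lerD2r.
  have hA : A / r * `|dot e w| <= A.
    by rewrite mulrAC -mulrA ler_piMr// ler_pdivrMr// mul1r.
  rewrite (_ : (A / r + B * k r + 1) * `|dot e w| =
    A / r * `|dot e w| + `|dot e w| + B * (k r * `|dot e w|)); last by ring.
  by rewrite lerD2r lerD// (le_trans er).
by rewrite ge0_integralD// lte_add_pinfty// ltey_eq ?I1 ?I2.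
Qed.

End projected_area.

(** * Finiteness for the two conditions, and the Pansu profile *)

Section profiles.
Context {R : realType}.
Implicit Types (b r lam : R) (h : R -> R).

Lemma C1_profile_integral_fin m b h : 0 < b ->
  (forall r, 0 < r < b -> derivable h r 1) -> C1_profile b h ->
  profile_integral (m := m) b h \is a fin_num.
Proof.
move=> b0 dh [g cg hg].
have [c1 _ g1] := EVT_max (ltW b0) cg; have [c2 _ g2] := EVT_min (ltW b0) cg.
apply: (@profile_integral_fin _ _ _ (`|g c1| + `|g c2|) 0) => // r rb.
rewrite mul0r addr0 (derive_within_interior rb (dh _ rb) (hg r _)); last first.
  by case/andP: rb => /ltW-> /ltW->.
have rI : r \in `[0, b] by rewrite in_itv/=; case/andP: rb => /ltW-> /ltW->.
have := g1 _ rI; have := g2 _ rI; have := ler_norm (g c1).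
have := ler_norm (- g c2); rewrite normrN ler_norml.
have := normr_ge0 (g c1); have := normr_ge0 (g c2).
by move=> *; apply/andP; split; lra.
Qed.

Lemma bounded_profile_integral_fin m b h : 0 < b ->
  (forall r, 0 < r < b -> derivable h r 1) -> bounded_profile b h ->
  profile_integral (m := m) b h \is a fin_num.
Proof.
move=> b0 dh [g hg].
apply: (@profile_integral_fin _ _ _ 0 b^-1) => //; first by rewrite invr_ge0 ltW.
move=> r rb; have [|hr] := hg r; first by case/andP: rb => /ltW-> ->.
rewrite (derive_within_interior rb (dh _ rb) hr) add0r => /le_trans; apply.
have -> : b ^+ 2 - r ^+ 2 = b ^+ 2 * (1 - b^-1 ^+ 2 * r ^+ 2).
  by field; rewrite gt_eqF.
by rewrite sqrtrM ?sqr_ge0// sqrtr_sqr gtr0_norm// invfM mulrCA.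
Qed.

Lemma pansu_domain lam r : 0 < lam -> 0 < r < lam^-1 ->
  0 < lam * r < 1 /\ 0 < 1 - lam ^+ 2 * r ^+ 2.
Proof.
move=> l0 /andP[r0 rl].
have lr0 : 0 < lam * r by rewrite mulr_gt0.
have lr1 : lam * r < 1 by rewrite -ltr_pdivlMl// mulr1.
split; first by rewrite lr0.
by rewrite -exprMn subr_gt0 expr_lt1// ltW.
Qed.

Lemma is_derive_pansu lam r : 0 < lam -> 0 < r < lam^-1 ->
  is_derive r 1 (pansu_profile lam)
    (- (lam * r ^+ 2 / Num.sqrt (1 - lam ^+ 2 * r ^+ 2))).
Proof.
move=> l0 rl; have [/andP[lr0 lr1] D0] := pansu_domain l0 rl.
set s := Num.sqrt (1 - lam ^+ 2 * r ^+ 2).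
have s0 : s != 0 by rewrite gt_eqF// sqrtr_gt0.
have ss : s ^+ 2 = 1 - lam ^+ 2 * r ^+ 2 by rewrite sqr_sqrtr// ltW.
have d1 : is_derive r 1 (fun x : R => 1 - lam ^+ 2 * x ^+ 2) (- (2 * lam ^+ 2 * r)).
  by apply: is_derive_eq; rewrite /GRing.scale/=; ring.
pose f1 (x : R) := 1 - lam ^+ 2 * x ^+ 2; pose f2 (x : R) := lam * x.
have d2 := @is_derive1_comp _ Num.sqrt f1 r _ _ (is_derive1_sqrt D0) d1.
have d3 : is_derive r 1 f2 lam.
  by apply: is_derive_eq; rewrite /GRing.scale/=; ring.
have d4 : is_derive r 1 (@acos R \o f2)
    (- (Num.sqrt (1 - (lam * r) ^+ 2))^-1 * lam).
  apply: is_derive1_comp; apply: is_derive1_acos.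
  by rewrite lr1 (lt_trans _ lr0)// oppr_lt0.
have d5 := is_deriveM d3 d2.
have d6 := is_deriveZ (2 * lam ^+ 2)^-1 (is_deriveD d5 d4).
apply: (is_derive_eq d6); rewrite /= /f1 /f2 exprMn -/s /GRing.scale/=.
have l0' : lam != 0 by rewrite gt_eqF.
apply: (mulfI s0); rewrite -/s.
transitivity ((2 * lam ^+ 2)^-1 * (lam * s ^+ 2 - lam - lam * (lam ^+ 2 * r ^+ 2))).
  by field; rewrite s0 l0'.
transitivity (- (lam * r ^+ 2)); last by field.
by rewrite ss; field.
Qed.

(** Hence the two sheets of the Pansu sphere do not meet inside the rim. *)
Lemma pansu_profile_gt0 lam r : 0 < lam -> 0 < r < lam^-1 ->
  0 < pansu_profile lam r.
Proof.
move=> l0 rl; have [/andP[lr0 lr1] _] := pansu_domain l0 rl.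
rewrite mulr_gt0 ?invr_gt0 ?mulr_gt0 ?exprn_gt0// ltr_wpDl//.
  by rewrite mulr_ge0 ?sqrtr_ge0// ltW.
by apply: acos_gt0; rewrite lr1 (le_trans _ (ltW lr0))// oppr_le0.
Qed.

(** The hypothesis is on |h'| so that it covers both sheets. It gives a^2 + 1 = 1 / (1 - lam^2 r^2)
    inside the rim. *)
Lemma profile_integral_pansu m lam h : 0 < lam ->
  (forall r, 0 < r < lam^-1 ->
    `|derive1 h r| = lam * r ^+ 2 / Num.sqrt (1 - lam ^+ 2 * r ^+ 2)) ->
  profile_integral (m := m) lam^-1 h =
  ((lam ^+ (2 * m.+1).+1)^-1 *
    (Num.sqrt pi ^+ (2 * m.+1) / Gamma (m.+1%:R + 1)))%:E.
Proof.
move=> l0 hE; have [_ vE] := @measure_pair_ballE R m.+1.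
rewrite EFinM -vE -radial_integral_pansu//.
congr pair_integral; apply/funext => w; set r := radius w.
have [rl|rl] := boolP (0 < r < lam^-1).
  congr (_ * _); rewrite area_profileE//.
  have [_ D0] := pansu_domain l0 rl; have /andP[r0 _] := rl.
  set s := Num.sqrt (1 - lam ^+ 2 * r ^+ 2).
  have s0 : 0 < s by rewrite sqrtr_gt0.
  have ss : s ^+ 2 = 1 - lam ^+ 2 * r ^+ 2 by rewrite sqr_sqrtr// ltW.
  have -> : (derive1 h r / r) ^+ 2 + 1 = s^-1 ^+ 2.
    rewrite expr_div_n -[derive1 h r ^+ 2]real_normK ?num_real// hE// -/s.
    apply: (mulfI (_ : s ^+ 2 != 0)); first by rewrite expf_eq0 gt_eqF.
    transitivity (lam ^+ 2 * r ^+ 2 + s ^+ 2); first by field; rewrite !gt_eqF.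
    by rewrite ss addrC subrK exprVn -ss divff// expf_eq0 gt_eqF.
  by rewrite sqrtr_sqr gtr0_norm// invr_gt0.
rewrite area_profile_out// mul0r.
(* Off the open interval the cut-off profile is 0. At r = 0 the Pansu density is 1 but <e, w>
   vanishes; for r >= 1 / lam the density itself is 0. *)
have := radius_ge0 w; rewrite le_eqVlt => /predU1P[r0|r0].
  rewrite (_ : dot _ w = 0) ?normr0 ?mulr0//.
  rewrite (radius_eq0 (esym r0)) /dot /rdot !big1 ?addr0// => i _;
    by rewrite !mxE mulr0.
move: rl; rewrite {1}/r r0/= -leNgt => lr.
rewrite ler0_sqrtr ?invr0 ?mul0r// subr_le0 -exprMn -[leLHS](expr1n _ 2).
have lr1 : 1 <= lam * r by rewrite -ler_pdivrMl// mulr1.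
by rewrite lerXn2r ?nnegrE// (le_trans ler01).
Qed.

End profiles.

Theorem theorem3 (R : realType) (n : nat) (hn : (1 <= n)%N)
    (lam : R) (hlam : 0 < lam) :
  (forall (Rr : R) (hp hm : R -> R),
     0 < Rr ->
     (forall r, 0 <= r <= Rr -> hm r <= 0 <= hp r) ->
     (forall r, 0 < r < Rr -> derivable hp r 1 /\ derivable hm r 1) ->
     compact (rot_surface n Rr hp hm) ->
     (C1_profile Rr hp \/ C1_profile Rr hm) \/
     (bounded_profile Rr hp \/ bounded_profile Rr hm) ->
     exists C : \bar R,
       (forall (N : heis R n -> heis R n) (p v : heis R n),
          pnormal_field Rr hp hm N ->
          is_pnormal (pansu_sphere n lam) p v ->
          projected_area Rr hp hm N p v = C) /\
       (C1_profile Rr hp \/ bounded_profile Rr hp ->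
        C1_profile Rr hm \/ bounded_profile Rr hm ->
        C \is a fin_num)) /\
  (forall (N : heis R n -> heis R n) (p v : heis R n),
     pnormal_field lam^-1 (pansu_profile lam)
       (fun r => - pansu_profile lam r) N ->
     is_pnormal (pansu_sphere n lam) p v ->
     projected_area lam^-1 (pansu_profile lam)
       (fun r => - pansu_profile lam r) N p v =
     (2%:E * unit_ball_volume R (2 * n - 1) *
      (Num.sqrt pi / lam ^+ (2 * n + 1) *
       (Gamma (n%:R + 2^-1) / Gamma (n%:R + 1)))%:E)%E).
Proof.
case: n hn => // m _; split.
  move=> b hp hm b0 hpm dh _ _.
  exists (profile_integral (m := m) b hp + profile_integral (m := m) b hm)%E; split.
    move=> N p v pN [_ _ _ vv _]; apply: projected_areaE => // r rb.
    have rI : r \in `]0, b[ by rewrite in_itv.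
    have dI t : t \in `]0, b[ -> derivable hp t 1 /\ derivable hm t 1.
      by rewrite in_itv; exact: dh.
    have sgn t : t \in `]0, b[ -> hm t <= 0 <= hp t.
      by rewrite in_itv/= => /andP[t0 tb]; apply: hpm; rewrite !ltW.
    move=> pm; have /andP[m0 p0] := sgn _ rI.
    (* At a meeting point hp = hm lies between 0 and 0, so [hp] has a minimum and [hm] a maximum
       there, both with derivative 0. *)
    have hp0 : hp r = 0 by apply/eqP; rewrite eq_le p0 pm m0.
    have hm0 : hm r = 0 by rewrite -pm.
    have dp : is_derive r 1 hp 0.
      apply: (derive1_at_min (ltW b0) _ rI) => [t /dI[]//|t /sgn/andP[_]].
      by rewrite hp0.
    have dm : is_derive r 1 hm 0.
      apply: (derive1_at_max (ltW b0) _ rI) => [t /dI[]//|t /sgn/andP[+ _]].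
      by rewrite hm0.
    by rewrite !derive1E !derive_val.
  have dp r : 0 < r < b -> derivable hp r 1 by move=> /dh[].
  have dm r : 0 < r < b -> derivable hm r 1 by move=> /dh[].
  move=> hP hM; rewrite fin_numD; apply/andP; split.
    by case: hP; [exact: C1_profile_integral_fin|exact: bounded_profile_integral_fin].
  by case: hM; [exact: C1_profile_integral_fin|exact: bounded_profile_integral_fin].
move=> N p v pN [_ _ _ vv _].
have dP r : 0 < r < lam^-1 -> is_derive r 1 (pansu_profile lam)
    (- (lam * r ^+ 2 / Num.sqrt (1 - lam ^+ 2 * r ^+ 2))).
  exact: is_derive_pansu.
have dM r : 0 < r < lam^-1 -> is_derive r 1 (fun r => - pansu_profile lam r)
    (lam * r ^+ 2 / Num.sqrt (1 - lam ^+ 2 * r ^+ 2)).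
  by move=> rl; rewrite -[X in is_derive _ _ _ X]opprK; exact: (is_deriveN (dP r rl)).
have s0 r : 0 < r < lam^-1 -> 0 <= lam * r ^+ 2 / Num.sqrt (1 - lam ^+ 2 * r ^+ 2).
  by move=> _; rewrite divr_ge0 ?sqrtr_ge0// mulr_ge0 ?sqr_ge0// ltW.
rewrite projected_areaE//; last 2 first.
- by move=> r rl; have ? := dP r rl; have ? := dM r rl; split; exact: ex_derive.
- move=> r rl /eqP; rewrite -subr_eq0 opprK -mulr2n mulrn_eq0/= => /eqP z.
  by have := pansu_profile_gt0 hlam rl; rewrite z ltxx.
rewrite !profile_integral_pansu//; last 2 first.
- move=> r rl; rewrite derive1E (@derive_val _ _ _ _ _ _ _ (dM r rl)).
  by rewrite ger0_norm// s0.
- move=> r rl; rewrite derive1E (@derive_val _ _ _ _ _ _ _ (dP r rl)).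
  by rewrite normrN ger0_norm// s0.
have [G0 ->] := @unit_ball_volumeE R (2 * m.+1 - 1).
(* The Gamma factor in the volume of the unit ball of R^(2n-1) is Gamma(n + 1/2), which cancels
   against the one in the claimed value. *)
have nE : (2 * m.+1 - 1)%:R / 2 + 1 = m.+1%:R + 2^-1 :> R.
  by rewrite natrB ?muln_gt0// natrM; field.
rewrite nE in G0 *; have [G1 _] := @measure_pair_ballE R m.+1.
rewrite -EFinD -!EFinM; congr EFin.
have -> : (2 * m.+1 + 1 = (2 * m.+1).+1)%N by rewrite addn1.
(* Of the factor pi^n from the ball of R^2n, the power sqrt(pi)^(2n-1) belongs to the smaller ball
   and one sqrt(pi) remains. *)
have -> : Num.sqrt pi ^+ (2 * m.+1) = Num.sqrt pi * Num.sqrt pi ^+ (2 * m.+1 - 1) :> R.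
  by rewrite -exprS subn1 prednK// muln_gt0.
move: G0 G1; set g0 := Gamma _; set g1 := Gamma _ => G0 G1.
by field; rewrite !gt_eqF// exprn_gt0.
Qed.
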